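(* If $G$ is a group with the BCQO property, then $\mathrm{d}(\chi_O(G))=0$.
   Context: $\mathbb{N}$ denotes the set of positive integers. A group $G$ has the BCQO property (''bounded cyclic quotient order'') if there exists $n\in\mathbb{N}$ such that every cyclic quotient of $G$ has order at most $n$ (in particular $G$ has no infinite cyclic quotient). For a group $G$, $\chi_F(G)$ denotes the set of orders of finite quotients of $G$, and $\chi_O(G)$ denotes the subset of odd integers in $\chi_F(G)$. For $X\subseteq\mathbb{N}$, the natural density is $\mathrm{d}(X)=\lim_{n\to\infty}\frac{|X\cap\{1,\ldots,n\}|}{n}$, if that limit exists; the statement $\mathrm{d}(X)=0$ includes existence of the limit. $G$ is not assumed to be finitely generated. *)

(* Defs.v *)
From HB Require Import structures.
From mathcomp Require Import all_boot all_order all_algebra.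
From mathcomp Require Import finmap.
From mathcomp Require Import mathcomp_extra boolp classical_sets functions.
From mathcomp Require Import cardinality reals topology normedtype sequences.

Set Implicit Arguments.
Unset Strict Implicit.
Unset Printing Implicit Defensive.

Import Order.TTheory GRing.Theory Num.Theory.
Import numFieldNormedType.Exports.

Local Open Scope classical_set_scope.
Local Open Scope card_scope.
Local Open Scope quotient_scope.
Local Open Scope group_scope.

Record normal_subgroup (G : groupType) := NormalSubgroup {
  nsg_set : set G;
  nsg1 : nsg_set 1;
  nsgM : forall x y, nsg_set x -> nsg_set y -> nsg_set (x * y);
  nsgV : forall x, nsg_set x -> nsg_set x^-1;
  nsgJ : forall x y, nsg_set x -> nsg_set (x ^ y) }.

Section QuotientGroup.
Variables (G : groupType) (N : normal_subgroup G).

(* [x N = y N] *)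
Definition coset_rel : rel G := fun x y => `[< nsg_set N (x^-1 * y) >].

Lemma coset_rel_refl : reflexive coset_rel.
Proof. by move=> x; apply/asboolP; rewrite mulVg; exact: nsg1. Qed.

Lemma coset_rel_sym : symmetric coset_rel.
Proof.
suff h x y : coset_rel x y -> coset_rel y x by move=> x y; apply/idP/idP; exact: h.
by move=> /asboolP /nsgV Nxy; apply/asboolP; rewrite invgM invgK in Nxy.
Qed.

Lemma coset_rel_trans : transitive coset_rel.
Proof.
move=> y x z /asboolP Nxy /asboolP Nyz; apply/asboolP.
by move: (nsgM Nxy Nyz); rewrite mulgA -(mulgA x^-1) mulgV mulg1.
Qed.

Canonical coset_rel_equiv :=
  EquivRel coset_rel coset_rel_refl coset_rel_sym coset_rel_trans.

Definition quot := {eq_quot coset_rel}.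

HB.instance Definition _ := Choice.on quot.

Definition to_quot (x : G) : quot := \pi_({eq_quot coset_rel}) x.

Lemma to_quotP x y : to_quot x = to_quot y <-> nsg_set N (x^-1 * y).
Proof.
split=> [/eqmodP/asboolP //|Nxy].
by apply/eqmodP/asboolP.
Qed.

Lemma to_quot_surj (a : quot) : exists x, to_quot x = a.
Proof. by exists (repr a); rewrite /to_quot reprK. Qed.

Let repr_quot (a : quot) : G := repr a.

Let repr_quotK a : to_quot (repr_quot a) = a.
Proof. exact: reprK. Qed.

Definition quot_one : quot := to_quot 1.
Definition quot_inv (a : quot) : quot := to_quot (repr_quot a)^-1.
Definition quot_mul (a b : quot) : quot := to_quot (repr_quot a * repr_quot b).

Let quot_mulE x y : quot_mul (to_quot x) (to_quot y) = to_quot (x * y).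
Proof.
have /to_quotP Nx := repr_quotK (to_quot x).
have /to_quotP Ny := repr_quotK (to_quot y).
rewrite /quot_mul; move: (repr_quot (to_quot x)) (repr_quot (to_quot y)) Nx Ny => u v Nu Nv.
apply/to_quotP; suff -> : (u * v)^-1 * (x * y) = (u^-1 * x) ^ v * (v^-1 * y).
  by apply: nsgM => //; exact: nsgJ.
by rewrite /conjg invgM !mulgA mulgK.
Qed.

Let quot_invE x : quot_inv (to_quot x) = to_quot x^-1.
Proof.
have /to_quotP Nx := repr_quotK (to_quot x).
rewrite /quot_inv; move: (repr_quot _) Nx => u Nu.
apply/to_quotP; have := nsgJ x^-1 (nsgV Nu).
by rewrite /conjg invgM !invgK !mulgA mulgV mul1g.
Qed.

Let quot_mulA : associative quot_mul.
Proof.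
move=> a b c; rewrite -[a]repr_quotK -[b]repr_quotK -[c]repr_quotK.
by rewrite !quot_mulE mulgA.
Qed.

Let quot_mul1 : left_id quot_one quot_mul.
Proof. by move=> a; rewrite -[a]repr_quotK quot_mulE mul1g. Qed.

Let quot_1mul : right_id quot_one quot_mul.
Proof. by move=> a; rewrite -[a]repr_quotK quot_mulE mulg1. Qed.

Let quot_mulV : left_inverse quot_one quot_inv quot_mul.
Proof. by move=> a; rewrite -[a]repr_quotK quot_invE quot_mulE mulVg. Qed.

Let quot_Vmul : right_inverse quot_one quot_inv quot_mul.
Proof. by move=> a; rewrite -[a]repr_quotK quot_invE quot_mulE mulgV. Qed.

HB.instance Definition _ :=
  isGroup.Build quot quot_mulA quot_mul1 quot_1mul quot_mulV quot_Vmul.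

Lemma to_quotM : {morph to_quot : x y / x * y}.
Proof. by move=> x y; rewrite -[LHS]quot_mulE. Qed.

End QuotientGroup.

(* As [^+] takes exponents in [nat], the two disjuncts cover the powers with
   exponent in Z. *)
Definition cyclic_group (G : groupType) : Prop :=
  exists g : G, forall x : G, exists k : nat, x = g ^+ k \/ x = g ^- k.

Definition BCQO (G : groupType) : Prop :=
  exists2 n : nat, (0 < n)%N &
    forall N : normal_subgroup G,
      cyclic_group (quot N) -> [set: quot N] #<= `I_n.

Definition chi_F (G : groupType) : set nat :=
  [set n | exists N : normal_subgroup G, [set: quot N] #= `I_n].

Definition chi_O (G : groupType) : set nat := chi_F G `&` [set n | odd n].

(* The limit exists and equals [d]. *)
Definition has_natural_density (R : realType) (X : set nat) (d : R) : Prop :=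
  (fun n : nat =>
     (#|` fset_set (X `&` [set k | (1 <= k <= n)%N])|%:R / n%:R : R)%R)
    @ \oo --> d.

(* Main.v *)
Require Import Defs.
From HB Require Import structures.
From mathcomp Require Import all_boot all_order all_algebra all_fingroup.
From mathcomp Require Import all_solvable all_field.
From mathcomp Require Import reals.
From mathcomp Require Import ring lra zify.

(** Let [n] bound the orders of the cyclic quotients of [G], and let [Q] be a
    quotient of odd order [m].

    For most [m], every large prime divisor [p] of [m] divides [m] exactly once,
    and no divisor [d > 1] of the [p]-smooth part of [m] is congruent to 1
    modulo [p].  By Sylow counting, [Q] then has a normal Hall
    subgroup [H] for the primes greater than [p], and [Q / H] has a normal Sylow
    subgroup [P] of order [p].  The group [Q / H] acts on [P] through a cyclic
    quotient of odd order [e <= n] dividing [p - 1].  If [e = 1], then [P] is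
    central, splits off, and gives a cyclic quotient of order [p > n].  So
    [p = 1] modulo some odd prime [q <= n].  (The Feit-Thompson theorem is not
    needed.)

    Hence [m] has no exact prime divisor [p] in the set of large primes that are
    quadratic nonresidues modulo every odd prime up to [n].  Such [m] have
    density zero because the sum of [1 / p] over this set diverges: for subsets
    [S] of the odd primes up to [n], let [chi_S] be the product of the Legendre
    symbols modulo the elements of [S].  The quotient of the product of the
    L-functions of the [chi_S] with [#|S|] even by the one with [#|S|] odd tends
    to infinity as [s] decreases to 1, since [L(1, chi_S) <> 0] for nonempty [S], while its Euler
    factor at [p] is trivial unless [chi_S p = (-1)^#|S|] for all [S]. *)

Set Implicit Arguments.
Unset Strict Implicit.
Unset Printing Implicit Defensive.

Import Order.TTheory GRing.Theory Num.Theory.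

(** * Normal Hall subgroups forced by the order *)

Local Open Scope group_scope.

Definition pi_gt (t : nat) : nat_pred := [pred q | t < q].

(* No [d > 1] can be the number of Sylow [p]-subgroups of a quotient whose order
   is the [p]-smooth part of [m]. *)
Definition sylow_forcing (m p : nat) : Prop :=
  forall d, d %| m`_(pi_gt p)^' -> d %% p = 1%N -> d = 1%N.

Lemma pcore_Hall_p'group (gT : finGroupType) (pi : nat_pred) (G : {group gT}) :
  pi^'.-group G -> pi.-Hall(G) 'O_pi(G).
Proof.
move=> pi'G; have hall1 : pi.-Hall(G) [1 gT].
  by rewrite pHallE sub1G cards1 part_p'nat ?eqxx.
by rewrite (normal_Hall_pcore hall1) // normal1.
Qed.

(** Downward induction on [t], starting where [|G| <= t]. Let [H] be the normal Hall subgroup for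
    the primes above [p = t + 1]. The order of [G / H] is the [p]-smooth part of [|G|], so if [p] is
    a prime dividing it, [sylow_forcing] leaves a single Sylow [p]-subgroup, whose preimage is the
    next Hall subgroup. *)
Lemma pcore_Hall_pi_gt (gT : finGroupType) (G : {group gT}) (t : nat) :
  (forall p, prime p -> t < p -> p %| #|G| -> sylow_forcing #|G| p) ->
  (pi_gt t).-Hall(G) 'O_(pi_gt t)(G).
Proof.
have [k] := ubnP (#|G| - t); elim: k t => // k IHk t /ltnSE-ltk forceG.
have [leGt | ltGt] := leqP #|G| t.
  apply: pcore_Hall_p'group; apply/pgroupP=> p p_pr pG.
  by rewrite !inE -leqNgt (leq_trans (dvdn_leq (cardG_gt0 G) pG) leGt).
set p := t.+1; pose H := 'O_(pi_gt p)(G)%G.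
have hallH : (pi_gt p).-Hall(G) H.
  apply: IHk => [|q q_pr ltpq]; last by apply: forceG => //; apply: ltnW.
  by rewrite (leq_trans _ ltk) // ltn_sub2l.
have nsHG : H <| G := pcore_normal _ _.
have piH : (pi_gt t).-group H.
  apply: sub_pgroup (pHall_pgroup hallH) => q; exact: ltnW.
have oGH : #|G / H| = (#|G|`_(pi_gt p)^')%N.
  rewrite card_quotient ?normal_norm // -divgS ?normal_sub // (card_Hall hallH).
  by rewrite -{1}(partnC (pi_gt p) (cardG_gt0 G)) mulKn ?part_gt0.
have nsHO : H <| 'O_(pi_gt t)(G).
  by rewrite (normalS _ _ nsHG) ?pcore_sub ?(pcore_max piH nsHG).
rewrite -(pquotient_pHall piH nsHG nsHO) /= -(pquotient_pcore nsHG piH).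
(* All primes dividing [|G / H|] are at most [p], so there [pi_gt t] reduces to [p]. *)
have eq_pi : {in \pi(G / H), pi_gt t =i (p : nat_pred)}.
  move=> q; rewrite mem_primes /= oGH => /and3P[q_pr _ qGH].
  have := pnatP _ (part_gt0 _ _) (part_pnat (pi_gt p)^' #|G|) q q_pr qGH.
  by rewrite !inE -leqNgt /p => le_q; rewrite eqn_leq le_q.
rewrite (eq_in_pHall _ eq_pi).
have [/andP[p_pr pGH] | not_pGH] := boolP (prime p && (p %| #|G / H|)).
  have /normal_sylowP[P sylP nsP] : #|'Syl_p(G / H)| == 1%N.
    apply/eqP; apply: (forceG p); rewrite ?card_Syl_mod // -?oGH ?card_Syl_dvd //.
    by rewrite (dvdn_trans pGH) // oGH dvdn_part.
  have hallP : (pi_gt t).-Hall(G / H) P by rewrite (eq_in_pHall _ eq_pi).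
  by have:= normal_Hall_pcore hallP nsP => /= ->.
rewrite -(eq_in_pHall _ eq_pi); apply: pcore_Hall_p'group.
apply/pgroupP=> q q_pr qGH; have := eq_pi q.
rewrite mem_primes q_pr cardG_gt0 qGH => /(_ isT) eq_q.
rewrite inE /= eq_q; apply: contra not_pGH; rewrite !inE => /eqP <-.
by rewrite q_pr.
Qed.

(** Phrased with a morphism rather than a normal subgroup, so that it pulls back along other maps by
    composition. *)
Definition cyclic_image (gT : finGroupType) (G : {group gT}) (e : nat) : Prop :=
  exists (rT : finGroupType) (f : {morphism G >-> rT}),
    cyclic (f @* G) /\ #|f @* G| = e.

Lemma cyclic_image_quotient (gT : finGroupType) (G N : {group gT}) (e : nat) :
  N <| G -> cyclic_image (G / N) e -> cyclic_image G e.
Proof.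
move=> nsNG [rT [f [cf ef]]].
have sG : G \subset coset N @*^-1 (G / N).
  by rewrite -sub_quotient_pre // normal_norm.
exists rT, [morphism of restrm sG [morphism of f \o coset N]].
by rewrite morphim_restrm setIid morphim_comp.
Qed.

(** If [G] centralises [P], a Schur-Zassenhaus complement of [P] is normal, with quotient isomorphic
    to [P]. Otherwise conjugation on [P] has a nontrivial image in [Aut P], which is cyclic of order
    [p - 1]. *)
Lemma cyclic_image_normal_Sylow (gT : finGroupType) (G P : {group gT}) (p : nat) :
    prime p -> p.-Sylow(G) P -> P <| G -> #|P| = p ->
  cyclic_image G p \/
    exists e, [/\ 1 < e, e %| #|G|, e %| p.-1 & cyclic_image G e].
Proof.
move=> p_pr sylP nsPG oP; have nPG := normal_norm nsPG.
have [cGP | not_cGP] := boolP (G \subset 'C(P)).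
  left; have /splitsP[K /complP[tiPK defG]] :=
    SchurZassenhaus_split (pHall_Hall sylP) nsPG.
  have sKG : K \subset G by rewrite -defG mulG_subr.
  have nsKG : K <| G.
    rewrite /normal sKG -defG mulG_subG normG andbT cents_norm //.
    by rewrite centsC (subset_trans sKG).
  exists _, (restrm_morphism (normal_norm nsKG) (coset_morphism K)).
  rewrite morphim_restrm setIid /= -/(G / K).
  have isoP : P \isog G / K.
    have nKP : P \subset 'N(K).
      exact: subset_trans (normal_sub nsPG) (normal_norm nsKG).
    by rewrite -defG quotientMidr quotient_isog 1?setIC.
  by rewrite -(isog_cyclic isoP) -(card_isog isoP) prime_cyclic oP.
right; exists #|conj_aut P @* G|.
have sAut : conj_aut P @* G \subset Aut P := Aut_conj_aut P G.
have cAut : cyclic (Aut P) by rewrite Aut_prime_cyclic ?oP.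
split.
- rewrite cardG_gt1; apply: contra not_cGP => tr.
  by rewrite -(ker_conj_aut P) ker_trivg_morphim nPG (eqP tr) subxx.
- by rewrite dvdn_morphim.
- rewrite (dvdn_trans (cardSg sAut)) // card_Aut_cyclic ?prime_cyclic ?oP //.
  by rewrite totient_prime.
exists _, (restrm_morphism nPG (conj_aut_morphism P)).
by rewrite morphim_restrm setIid (cyclicS sAut).
Qed.

(** Let [H] and [K] be the normal Hall subgroups for the primes above [p] and for those at least
    [p]. Then [K / H] is a normal Sylow subgroup of order [p] in [G / H], and the dichotomy for it
    pulls back to [G]. *)
Lemma cyclic_image_pfactor (gT : finGroupType) (G : {group gT}) (p : nat) :
    prime p -> logn p #|G| = 1%N ->
    (forall q, prime q -> p <= q -> q %| #|G| -> sylow_forcing #|G| q) ->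
  cyclic_image G p \/
    exists e, [/\ 1 < e, e %| #|G|, e %| p.-1 & cyclic_image G e].
Proof.
move=> p_pr pG forceG.
pose H := 'O_(pi_gt p)(G)%G; pose K := 'O_(pi_gt p.-1)(G)%G.
have p1 : p.-1.+1 = p by rewrite prednK ?prime_gt0.
have hallH : (pi_gt p).-Hall(G) H.
  by apply: pcore_Hall_pi_gt => q q_pr /ltnW; apply: forceG.
have hallK : (pi_gt p.-1).-Hall(G) K.
  by apply: pcore_Hall_pi_gt => q q_pr; rewrite p1; apply: forceG.
have nsHG : H <| G := pcore_normal _ _.
have nsKG : K <| G := pcore_normal _ _.
have piH : (pi_gt p.-1).-group H.
  apply: sub_pgroup (pHall_pgroup hallH) => q; rewrite !inE p1; exact: ltnW.
have nsHK : H <| K.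
  by rewrite (normalS _ _ nsHG) ?pcore_sub ?(pcore_max piH nsHG).
have oGH : #|G / H| = (#|G|`_(pi_gt p)^')%N.
  rewrite card_quotient ?normal_norm // -divgS ?normal_sub // (card_Hall hallH).
  by rewrite -{1}(partnC (pi_gt p) (cardG_gt0 G)) mulKn ?part_gt0.
have eq_pi : {in \pi(G / H), pi_gt p.-1 =i (p : nat_pred)}.
  move=> q; rewrite mem_primes /= oGH => /and3P[q_pr _ qGH].
  have := pnatP _ (part_gt0 _ _) (part_pnat (pi_gt p)^' #|G|) q q_pr qGH.
  by rewrite !inE -leqNgt p1 => le_q; rewrite eqn_leq le_q.
have sylP : p.-Sylow(G / H) (K / H).
  by rewrite -(eq_in_pHall _ eq_pi) pquotient_pHall.
have oP : #|K / H| = p.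
  rewrite (card_Hall sylP) oGH -partnI (@eq_partn _ p); last first.
    move=> q; rewrite !inE -leqNgt; case: eqP => [->|]; rewrite ?leqnn ?andbT ?andbF //.
  by rewrite p_part pG expn1.
case: (cyclic_image_normal_Sylow p_pr sylP (quotient_normal _ nsKG) oP) => [cp|].
  by left; apply: cyclic_image_quotient cp.
case=> e [e1 eG ep ce]; right; exists e; split=> //; last first.
  exact: cyclic_image_quotient ce.
by rewrite (dvdn_trans eG) // dvdn_quotient.
Qed.

Local Close Scope group_scope.

(** * Counting integers *)

Local Open Scope nat_scope.

Lemma big_multiples (V : nmodType) (f : nat -> V) (q x : nat) : 0 < q ->
  (\sum_(1 <= m < x.+1 | (q %| m)%N) f m = \sum_(1 <= m < (x %/ q)%N.+1) f (q * m)%N)%R.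
Proof.
move=> q_gt0; elim: x => [|x IHx]; first by rewrite div0n !big_geq.
rewrite divnS // big_mkcond big_nat_recr //= -big_mkcond IHx.
case: ifP => [/dvdnP[k def_k] | _]; last by rewrite addr0.
rewrite add1n [RHS]big_nat_recr //= -(_ : x.+1 = q * (x %/ q).+1) //.
have /eqP := divnS x q_gt0; rewrite def_k mulnK // dvdn_mull //= add1n => /eqP <-.
by rewrite mulnC.
Qed.

Lemma count_sum (P : pred nat) (x : nat) :
  count P (iota 1 x) = \sum_(1 <= m < x.+1) P m.
Proof. by rewrite -big_mkcond -sum1_count /index_iota subSS subn0. Qed.

Lemma count_multiples (d x : nat) : 0 < d -> count (dvdn d) (iota 1 x) = x %/ d.
Proof.
move=> d_gt0; rewrite count_sum -(big_mkcond (dvdn d) (fun=> 1)).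
by rewrite (big_multiples (fun=> 1)) // sum_nat_const_nat muln1 subSS subn0.
Qed.

Lemma count_has_le (T U : Type) (P : T -> pred U) (s : seq T) (t : seq U) :
  count (fun u => has (P^~ u) s) t <= \sum_(i <- s) count (P i) t.
Proof.
elim: s => [|i s IHs] /=; first by rewrite big_nil count_pred0.
rewrite big_cons (leq_trans _ (leq_add (leqnn _) IHs)) //.
by rewrite -[leqRHS]count_predUI leq_addr.
Qed.

Lemma count_ord (P : pred nat) (x : nat) :
  count P (iota 1 x) = #|[pred i : 'I_x | P i.+1]|.
Proof.
rewrite count_sum big_add1 big_mkord -sum1_card [RHS]big_mkcond.
by apply: eq_bigr => i _; rewrite inE; case: (P _).
Qed.

(** * Periodic sets of integers and exact prime divisors *)

Definition periodic (T : Type) (M : nat) (f : nat -> T) : Prop :=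
  forall m, f (m + M) = f m.

Section Periodic.
Variables (T : Type) (M : nat) (f : nat -> T).
Hypothesis perf : periodic M f.

Lemma periodicM k m : f (m + k * M) = f m.
Proof. by elim: k => [|k IHk]; rewrite ?addn0 // mulSnr addnA perf. Qed.

Lemma periodic_mod m : f (m %% M) = f m.
Proof. by rewrite {2}(divn_eq m M) addnC periodicM. Qed.

Lemma periodic_dvd N : M %| N -> periodic N f.
Proof. by move=> /dvdnP[k ->] m; rewrite periodicM. Qed.

End Periodic.

(** Rounding [x] up to a multiple of [M] adds at most one period. *)
Lemma count_periodic_le (M x : nat) (P : pred nat) : 0 < M -> periodic M P ->
  count P (iota 1 x) <= (x %/ M).+1 * count P (iota 1 M).
Proof.
move=> M_gt0 perP; have block k : count P (iota 1 (k * M)) = k * count P (iota 1 M).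
  elim: k => [|k IHk]; first by rewrite mul0n.
  rewrite mulSnr iotaD count_cat IHk mulSnr; congr (_ + _).
  rewrite -[1 + _]addnC iotaDl count_map; apply: eq_count => m /=.
  by rewrite addnC periodicM.
rewrite -block -(subnKC (ltnW (ltn_ceil x M_gt0))) iotaD count_cat.
exact: leq_addr.
Qed.

(** By the Chinese remainder theorem, reduction modulo [M] and [N] is injective on a period of
    length [M * N]. *)
Lemma count_coprime_periodic_le (M N : nat) (P Q : pred nat) :
    0 < M -> 0 < N -> coprime M N -> periodic M P -> periodic N Q ->
  count (predI P Q) (iota 1 (M * N)) <= count P (iota 1 M) * count Q (iota 1 N).
Proof.
move=> M_gt0 N_gt0 co_MN perP perQ; rewrite !count_ord -cardX.
pose h (i : 'I_(M * N)) : 'I_M * 'I_N :=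
  (Ordinal (ltn_pmod i M_gt0), Ordinal (ltn_pmod i N_gt0)).
have h_inj : injective h.
  move=> i j [eqM eqN]; apply/val_inj/eqP => /=.
  rewrite -[val i](modn_small (ltn_ord i)) -[val j](modn_small (ltn_ord j)).
  by rewrite chinese_remainder // eqM eqN !eqxx.
rewrite -(card_image h_inj); apply/subset_leq_card/subsetP=> _ /imageP[i + ->].
rewrite !inE /= => /andP[Pi Qi].
(* The ordinal [i] stands for the integer [i + 1], so residues are shifted by one. *)
have shift (K : nat) (E : pred nat) : periodic K E -> E (i %% K).+1 = E i.+1.
  move=> perE; rewrite -(periodic_mod perE (i %% K).+1) -addn1 modnDml addn1.
  exact: periodic_mod.
by rewrite (shift M P) // (shift N Q) // Pi.
Qed.

Definition exact_dvd (p m : nat) : bool := (p %| m) && ~~ (p ^ 2 %| m).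

Lemma logn_exact_dvd (p m : nat) : prime p -> 0 < m ->
  exact_dvd p m = (logn p m == 1).
Proof.
move=> p_pr m_gt0; rewrite /exact_dvd -{1}(expn1 p) !pfactor_dvdn //.
by case: (logn p m) => [|[|k]].
Qed.

Lemma periodic_dvdn d : periodic d (dvdn d).
Proof. by move=> m; rewrite /= dvdn_addl. Qed.

Lemma periodic_exact_dvd p : periodic (p ^ 2) (exact_dvd p).
Proof.
move=> m; rewrite /exact_dvd; congr (_ && ~~ _); last exact: periodic_dvdn.
by apply: (periodic_dvd (@periodic_dvdn p)); rewrite dvdn_exp.
Qed.

(** These are the [p ^ 2 - p] non-multiples of [p], and [p ^ 2] itself. *)
Lemma count_not_exact_dvd p : 0 < p ->
  count (fun m => ~~ exact_dvd p m) (iota 1 (p ^ 2)) = p ^ 2 - p + 1.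
Proof.
move=> p_gt0; pose s := iota 1 (p ^ 2).
have defC : count (predC (dvdn p)) s = p ^ 2 - p.
  have := count_predC (dvdn p) s.
  by rewrite size_iota count_multiples // -{1}(mulnn p) mulnK // => <-; rewrite addKn.
have def1 : count (dvdn (p ^ 2)) s = 1.
  by rewrite count_multiples ?divnn ?expn_gt0 ?p_gt0.
transitivity (count (predC (dvdn p)) s + count (dvdn (p ^ 2)) s); last first.
  by rewrite defC def1.
rewrite -count_predUI.
rewrite (eq_count (a1 := predI _ _) (a2 := pred0)) ?count_pred0 ?addn0 => [|m /=].
  by apply: eq_count => m /=; rewrite negb_and negbK.
apply/andP=> [[/negP not_pm p2m]]; apply: not_pm.
by apply: dvdn_trans p2m; rewrite dvdn_exp.
Qed.

Definition no_exact_dvd (T : seq nat) (m : nat) : bool :=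
  all (fun p => ~~ exact_dvd p m) T.

Lemma periodic_no_exact_dvd T : periodic (\prod_(p <- T) p ^ 2) (no_exact_dvd T).
Proof.
elim: T => [|p T IHT] m //; rewrite big_cons /no_exact_dvd /=.
congr (~~ _ && _); last by apply: (periodic_dvd IHT); rewrite dvdn_mull.
by apply: (periodic_dvd (@periodic_exact_dvd p)); rewrite dvdn_mulr.
Qed.

Lemma count_no_exact_dvd_le (T : seq nat) : uniq T -> all prime T ->
  count (no_exact_dvd T) (iota 1 (\prod_(p <- T) p ^ 2))
    <= \prod_(p <- T) (p ^ 2 - p + 1).
Proof.
elim: T => [|p T IHT] /=; first by rewrite !big_nil.
case/andP=> pT uniqT /andP[p_pr prT]; rewrite !big_cons.
have p_gt0 := prime_gt0 p_pr.
rewrite -count_not_exact_dvd //.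
apply: leq_trans (leq_mul (leqnn _) (IHT uniqT prT)).
apply: count_coprime_periodic_le.
- by rewrite expn_gt0 p_gt0.
- rewrite big_seq_cond prodn_cond_gt0 // => q; rewrite andbT expn_gt0.
  by move/(allP prT)/prime_gt0 ->.
- rewrite coprimeXl // big_seq_cond; apply: (big_ind (coprime p)) => [|a b|q].
  + exact: coprimen1.
  + by rewrite coprimeMr => -> ->.
  + rewrite andbT => qT; have q_pr := allP prT q qT.
    rewrite coprimeXr // prime_coprime // dvdn_prime2 //.
    by apply: contraNneq pT => ->.
- move=> m; congr (~~ _); exact: periodic_exact_dvd.
- exact: periodic_no_exact_dvd.
Qed.

(** Bounds the counts themselves from some point on, in place of a limit superior. *)
Definition upper_density_le (R : realType) (P : pred nat) (eps : R) : Prop :=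
  exists x0, forall x, x0 <= x ->
    ((count P (iota 1 x))%:R <= eps * x%:R)%R.

(** One period [M] contains at most [K = delta * M] such integers. The incomplete last period adds
    at most [K], which the gap [eps - delta] absorbs once [x] is large. *)
Lemma upper_density_no_exact_dvd (R : realType) (T : seq nat) (eps : R) :
    uniq T -> all prime T -> (\prod_(p <- T) (1 - p%:R^-1 + p%:R^-2) < eps)%R ->
  upper_density_le (no_exact_dvd T) eps.
Proof.
move=> uniqT prT lt_eps.
pose M := \prod_(p <- T) p ^ 2; pose K := \prod_(p <- T) (p ^ 2 - p + 1).
set delta : R := (\prod_(p <- T) _)%R in lt_eps.
have M_gt0 : 0 < M.
  rewrite /M big_seq_cond prodn_cond_gt0 // => q; rewrite andbT expn_gt0.
  by move/(allP prT)/prime_gt0 ->.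
have defK : (K%:R = delta * M%:R :> R)%R.
  rewrite /K /M /delta !natr_prod -big_split /=; apply: eq_big_seq => p /(allP prT) p_pr.
  have p_neq0 : (p%:R != 0 :> R)%R by rewrite pnatr_eq0 -lt0n prime_gt0.
  rewrite natrD natrB; last by rewrite -{1}(expn1 p) leq_pexp2l ?prime_gt0.
  by rewrite natrX -exprVn; field.
pose x0 := Num.bound (K%:R / (eps - delta)).
exists x0 => x le_x0x.
have perT : periodic M (no_exact_dvd T) := @periodic_no_exact_dvd T.
have := count_periodic_le x M_gt0 perT.
move=> /leq_trans /(_ (leq_mul (leqnn _) (count_no_exact_dvd_le uniqT prT))).
rewrite -/K -(ler_nat R) => /le_trans; apply; rewrite natrM -natr1.
have K_ge0 : (0 <= K%:R :> R)%R by [].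
have le_div : ((x %/ M)%:R * M%:R <= x%:R :> R)%R by rewrite -natrM ler_nat leq_trunc_div.
have ltK : (K%:R < (eps - delta) * x%:R)%R.
  have gap_gt0 : (0 < eps - delta)%R by rewrite subr_gt0.
  rewrite mulrC -ltr_pdivrMr //.
  have /archi_boundP lt_bound : (0 <= K%:R / (eps - delta))%R by rewrite divr_ge0 // ltW.
  by apply: (lt_le_trans lt_bound); rewrite ler_nat.
have delta_ge0 : (0 <= delta)%R.
  by rewrite -(pmulr_lge0 _ (_ : 0 < M%:R)%R) ?ltr0n // -defK.
have : (delta * ((x %/ M)%:R * M%:R) <= delta * x%:R)%R by rewrite ler_wpM2l.
rewrite mulrDl mul1r {1}defK; nra.
Qed.

(** The number of prime factors of [m] up to [t], with multiplicity: [logn q m = 0] unless [q] is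
    prime. *)
Definition smooth_omega (t m : nat) : nat := \sum_(0 <= q < t.+1) logn q m.

Lemma smooth_part_le (t m : nat) : 0 < t -> 0 < m ->
  m`_(pi_gt t)^' <= t ^ smooth_omega t m.
Proof.
move=> t_gt0 m_gt0; rewrite (@widen_partn (maxn m t)) ?leq_maxl //.
rewrite /smooth_omega expn_sum.
rewrite (@big_cat_nat _ _ _ t.+1) //=; last by rewrite ltnS leq_maxr.
rewrite [X in _ * X]big1_seq ?muln1 => [|q]; last first.
  by rewrite mem_index_iota !inE => /andP[q_le /andP[q_gt _]]; rewrite q_gt in q_le.
rewrite big_nat_cond [leqRHS]big_nat_cond big_mkcond [leqRHS]big_mkcond /=.
elim/big_ind2: _ => // [a b c d|q _]; first exact: leq_mul.
rewrite ltnS; case: (leqP q t) => //= le_qt; case: ifP => _.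
  by case: (logn q m) => // k; rewrite leq_exp2r.
by rewrite expn_gt0 t_gt0.
Qed.

Lemma smooth_omegaS (t m : nat) :
  smooth_omega t.+1 m = smooth_omega t m + logn t.+1 m.
Proof. by rewrite /smooth_omega big_nat_recr. Qed.

Lemma smooth_omega_mulS (t m : nat) : prime t.+1 -> 0 < m ->
  smooth_omega t.+1 (t.+1 * m) = (smooth_omega t.+1 m).+1.
Proof.
move=> t_pr m_gt0; rewrite !smooth_omegaS lognM // logn_prime // eqxx.
rewrite add1n addnS; congr (_ + _).+1.
apply: eq_big_nat => q /andP[_ lt_qt]; rewrite lognM // logn_prime //.
by rewrite (ltn_eqF lt_qt).
Qed.

(** * Counting the multiples of a prime that are bad for it *)

Section WeightedCount.
Variable R : realType.
Local Open Scope ring_scope.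

(* Rankin's trick: splitting off the multiples of the prime [t.+1] turns a bound
   for [t] into one for [t.+1], with a loss of at most [1 / (1 - 3 / (2 (t + 1)))]. *)
Lemma smooth_weight_sum_le (t y : nat) : (0 < t)%N ->
  \sum_(1 <= m < y.+1) (3 / 2 : R) ^+ smooth_omega t m <= t%:R ^+ 2 * y%:R.
Proof.
case: t => // t _; elim: t y => [|t IHt] y.
  rewrite (eq_big_nat _ _ (F2 := fun=> 1)) => [|m _].
    by rewrite sumr_const_nat subSS subn0 expr1n mul1r.
  by rewrite /smooth_omega !big_nat_recr //= big_geq // /logn /= expr0.
set q := t.+2; have [q_pr | q_npr] := boolP (prime q); last first.
  rewrite (eq_bigr (fun m => (3 / 2) ^+ smooth_omega t.+1 m)) => [|m _]; last first.
    by rewrite [in LHS]/q smooth_omegaS [logn _ _]lognE (negPf q_npr) addn0.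
  apply: le_trans (IHt y) _; apply: ler_wpM2r => //.
  by rewrite lerXn2r ?nnegrE ?ler_nat.
(* Inner induction on [y]: the multiples of [q] lead back to the same sum up to [y %/ q]. *)
have [n] := ubnP y; elim: n y => // n IHn y /ltnSE-le_yn.
have [-> | y_gt0] := posnP y; first by rewrite big_geq // mulr0.
rewrite (bigID (dvdn q)) /= (big_multiples (fun m => (3 / 2) ^+ smooth_omega q m)) //.
rewrite (eq_big_nat _ _ (F2 := fun m => 3 / 2 * (3 / 2) ^+ smooth_omega q m)); last first.
  by move=> m /andP[m_gt0 _]; rewrite smooth_omega_mulS // exprS.
rewrite -mulr_sumr.
have lt_div : (y %/ q < n)%N by apply: leq_trans le_yn; rewrite ltn_Pdiv.
have := IHn _ lt_div; set F := \sum_(_ <= _ < _) _ => leF.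
have leG : \sum_(1 <= m < y.+1 | ~~ (q %| m)%N) (3 / 2 : R) ^+ smooth_omega q m
    <= t.+1%:R ^+ 2 * y%:R.
  apply: le_trans (IHt y); rewrite big_mkcond /=; apply: ler_sum_nat => m /andP[m_gt0 _].
  case: ifPn => [not_qm|_]; last by rewrite exprn_ge0 // divr_ge0.
  by rewrite [in leLHS]/q smooth_omegaS [logn _ _]lognE (negPf not_qm) !andbF addn0.
have le_div : (y %/ q)%:R * q%:R <= y%:R :> R by rewrite -natrM ler_nat leq_trunc_div.
have q_gt1 : 2 <= q%:R :> R by rewrite ler_nat.
have defq : q%:R = t.+1%:R + 1 :> R by rewrite natr1.
have t_ge1 : 1 <= t.+1%:R :> R by rewrite ler1n.
have y_ge0 : 0 <= y%:R :> R by [].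
rewrite expr2 in leF.
move: leG; set H := \sum_(1 <= i < y.+1 | ~~ _) _; move: H => H leG.
move: leF le_div leG; rewrite defq.
move: (t.+1%:R : R) t_ge1 => T T1.
move: (y%:R : R) y_ge0 => Y Y0; move: ((y %/ q)%:R : R) => Z; move: F => F.
rewrite !expr2 => h1 h2 h3.
(* With [q = T + 1], what remains is [3/2 q + (q - 1)^2 <= q^2], true for [q >= 2]. *)
have h4 : (T + 1) * (Z * (T + 1)) <= (T + 1) * Y by rewrite ler_wpM2l // addr_ge0 // (le_trans _ T1).
have h5 : 0 <= Y * (T - 1) by rewrite mulr_ge0 // subr_ge0.
lra.
Qed.

(** Each dyadic block contributes at most 1. *)
Lemma harmonic_pow2_le (k : nat) :
  \sum_(1 <= j < 2 ^ k) (j%:R^-1 : R) <= k%:R.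
Proof.
elim: k => [|k IHk]; first by rewrite expn0 big_geq.
have k2_gt0 : (0 < 2 ^ k)%N by rewrite expn_gt0.
rewrite (@big_cat_nat _ _ _ (2 ^ k)) //=; last by rewrite leq_exp2l.
rewrite -natr1 lerD // (le_trans (_ : _ <= \sum_(2 ^ k <= j < 2 ^ k.+1) (2 ^ k)%:R^-1)) //.
  apply: ler_sum_nat => j /andP[le_kj _].
  by rewrite lef_pV2 ?posrE ?ltr0n ?ler_nat // (leq_trans k2_gt0).
rewrite sumr_const_nat expnS mul2n -addnn addnK -[leLHS]mulr_natr mulVf //.
by rewrite pnatr_eq0 -lt0n.
Qed.

Definition log2S (p : nat) : nat := (trunc_log 2 p).+1.

(* The second clause catches the divisors [d = 1 + j p] of the [p]-smooth part of
   [m] that are at most [p ^ (8 * log2S p)], the third one all larger ones. *)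
Definition bad_prime (p m : nat) : bool :=
  [|| (p ^ 2 %| m)%N,
      has (fun j => p * (1 + j * p) %| m)%N (iota 1 (2 ^ (8 * log2S p ^ 2)).-1)
    | (8 * log2S p <= smooth_omega p m)%N].

(** Markov's inequality for the weight [(3/2) ^ smooth_omega p m]. *)
Lemma count_smooth_omega_le (p x a : nat) : (0 < p)%N ->
  (count (fun m => (a <= smooth_omega p m)%N) (iota 1 x))%:R
    <= (2 / 3 : R) ^+ a * (p%:R ^+ 2 * x%:R).
Proof.
move=> p_gt0; rewrite count_sum natr_sum.
apply: le_trans (ler_wpM2l _ (smooth_weight_sum_le x p_gt0)); last first.
  by rewrite exprn_ge0 // divr_ge0.
rewrite mulr_sumr; apply: ler_sum_nat => m _.
have pos k : 0 <= (3 / 2 : R) ^+ k by rewrite exprn_ge0 // divr_ge0.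
have pos' k : 0 <= (2 / 3 : R) ^+ k by rewrite exprn_ge0 // divr_ge0.
case: leqP => [le_am|_]; last by rewrite mulr_ge0.
rewrite -(subnK le_am) addnC exprD mulrA -exprMn.
have -> : 2 / 3 * (3 / 2) = 1 :> R by field.
by rewrite expr1n mul1r exprn_ege1 //; lra.
Qed.

(** With [l = log2S p], the first and third clauses cost at most [x / p^2] each, the second at most
    [8 l^2 x / p^2]. *)
Lemma count_bad_prime_le (p x : nat) : prime p ->
  (count (bad_prime p) (iota 1 x))%:R
    <= 10 * (log2S p)%:R ^+ 2 / p%:R ^+ 2 * x%:R :> R.
Proof.
move=> p_pr; have p_gt0 := prime_gt0 p_pr.
set l := log2S p; set K := (8 * l ^ 2)%N.
have p0 : 0 < p%:R :> R by rewrite ltr0n.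
have p2 : 0 < p%:R ^+ 2 :> R by rewrite exprn_gt0.
have div_le d : (0 < d)%N -> (x %/ d)%:R <= x%:R / d%:R :> R.
  by move=> d_gt0; rewrite ler_pdivlMr ?ltr0n // -natrM ler_nat leq_trunc_div.
have bnd1 : (count (dvdn (p ^ 2)) (iota 1 x))%:R <= x%:R / p%:R ^+ 2 :> R.
  by rewrite count_multiples ?expn_gt0 ?p_gt0 // -natrX div_le // expn_gt0 p_gt0.
pose Q j m := (p * (1 + j * p) %| m)%N.
have bnd2 : (count (fun m => has (Q^~ m) (iota 1 (2 ^ K).-1)) (iota 1 x))%:R
    <= x%:R / p%:R ^+ 2 * K%:R :> R.
  apply: le_trans (_ : (\sum_(j <- iota 1 (2 ^ K).-1) count (Q j) (iota 1 x))%:R <= _).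
    by rewrite ler_nat count_has_le.
  rewrite natr_sum; apply: le_trans (ler_wpM2l _ (harmonic_pow2_le K)); last first.
    by rewrite divr_ge0 // ltW.
  rewrite mulr_sumr /index_iota subn1 !big_seq; apply: ler_sum => j.
  rewrite mem_iota => /andP[j_gt0 _].
  have d_gt0 : (0 < p * (1 + j * p))%N by rewrite muln_gt0 p_gt0.
  rewrite /Q count_multiples // (le_trans (div_le _ d_gt0)) // -mulrA.
  (* As [p (1 + j p) >= j p^2], the sum over [j] is dominated by a harmonic sum. *)
  rewrite ler_wpM2l // -invfM lef_pV2 ?posrE ?ltr0n // ?mulr_gt0 ?ltr0n //.
  by rewrite -natrX -natrM ler_nat expnS expn1 -mulnA leq_mul // mulnC leq_addl.
have l_gt0 : (0 < l)%N by [].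
have bnd3 : (count (fun m => (8 * l <= smooth_omega p m)%N) (iota 1 x))%:R
    <= x%:R / p%:R ^+ 2 :> R.
  apply: le_trans (count_smooth_omega_le _ _ p_gt0) _.
  have lt_pl : p%:R <= 2 ^+ l :> R.
    by rewrite -natrX ler_nat ltnW // trunc_log_ltn.
  (* The factor 8 suffices because [2^4 (2/3)^8 = 4096/6561 < 1]. *)
  have pow4 : p%:R ^+ 4 * (2 / 3) ^+ (8 * l) <= 1 :> R.
    apply: (@le_trans _ _ ((2 ^+ l) ^+ 4 * (2 / 3) ^+ (8 * l))).
      rewrite ler_wpM2r ?lerXn2r ?nnegrE //; last exact: exprn_ge0.
      by rewrite exprn_ge0 // divr_ge0.
    rewrite -exprM mulnC !exprM -exprMn exprn_ile1 //; first by rewrite mulr_ge0 ?exprn_ge0 ?divr_ge0.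
    lra.
  rewrite ler_pdivlMr //; move: pow4; set w := (_ ^+ (8 * l)) => pow4.
  have -> : w * (p%:R ^+ 2 * x%:R) * p%:R ^+ 2 = p%:R ^+ 4 * w * x%:R :> R by ring.
  by rewrite -[leRHS]mul1r ler_wpM2r.
apply: (@le_trans _ _ (x%:R / p%:R ^+ 2 + (x%:R / p%:R ^+ 2 * K%:R + x%:R / p%:R ^+ 2))).
  apply: le_trans (lerD bnd1 (lerD bnd2 bnd3)).
  rewrite -!natrD ler_nat.
  have count_orb A B s : (count (fun m : nat => A m || B m) s <= count A s + count B s)%N.
    by rewrite -(count_predUI A B) leq_addr.
  apply: leq_trans (count_orb _ _ _) _; rewrite leq_add2l; exact: count_orb.
have -> : x%:R / p%:R ^+ 2 + (x%:R / p%:R ^+ 2 * K%:R + x%:R / p%:R ^+ 2)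
    = (2 + K%:R) / p%:R ^+ 2 * x%:R :> R by field; rewrite gt_eqF.
rewrite ler_wpM2r // ler_wpM2r ?invr_ge0 ?(ltW p2) // /K natrM natrX.
have : 1 <= l%:R ^+ 2 :> R by rewrite exprn_ege1 // ler1n.
lra.
Qed.

Lemma sum_log2S_tail_le (i j : nat) : (i <= j)%N ->
  \sum_(2 ^ i <= p < 2 ^ j) (log2S p)%:R ^+ 2 / p%:R ^+ 2
    <= (2 * i%:R ^+ 2 + 8 * i%:R + 12) / 2 ^+ i :> R.
Proof.
(* [u] satisfies [u n - u (n + 1) = (n + 1)^2 / 2^n], which bounds the block from [2^n] to
   [2^(n + 1)], where [log2S] is [n + 1]. The blocks then telescope. *)
pose u (k : nat) : R := (2 * k%:R ^+ 2 + 8 * k%:R + 12) / 2 ^+ k.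
have u_ge0 k : 0 <= u k by rewrite divr_ge0 ?exprn_ge0 // !addr_ge0 // ?mulr_ge0 ?exprn_ge0.
move=> le_ij; suff : \sum_(2 ^ i <= p < 2 ^ j) (log2S p)%:R ^+ 2 / p%:R ^+ 2 <= u i - u j.
  by move=> /le_trans; apply; rewrite gerBl.
rewrite -(subnKC le_ij); elim: (j - i)%N => [|k IHk] {le_ij}; first by rewrite addn0 subrr big_geq.
rewrite addnS (@big_cat_nat _ _ _ (2 ^ (i + k))) ?leq_exp2l ?leq_addr //=.
set n := (i + k)%N in IHk *.
have -> : u i - u n.+1 = u i - u n + (u n - u n.+1) by rewrite addrA subrK.
rewrite lerD // (le_trans (_ : _ <= \sum_(2 ^ n <= p < 2 ^ n.+1) (n.+1%:R ^+ 2 / (2 ^ n)%:R ^+ 2))) //.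
  apply: ler_sum_nat => p /andP[le_p lt_p].
  have -> : log2S p = n.+1 by rewrite /log2S (@trunc_log_eq 2 n p) // le_p.
  have n2 : (0 < 2 ^ n)%N by rewrite expn_gt0.
  rewrite ler_wpM2l ?exprn_ge0 // lef_pV2 ?posrE ?exprn_gt0 ?ltr0n ?(leq_trans n2) //.
  by rewrite lerXn2r ?nnegrE ?ler_nat.
rewrite sumr_const_nat expnS mul2n -addnn addnK -[leLHS]mulr_natr /u !natrX (exprS 2 n) -natr1.
have : (2 ^+ n != 0 :> R) by rewrite expf_neq0 // pnatr_eq0.
move: (2 ^+ n : R) => P P0; move: (n%:R : R) => N.
rewrite le_eqVlt; apply/orP; left; apply/eqP; field.
by rewrite P0.
Qed.

End WeightedCount.

(** A divisor [d = 1 + j p] of the smooth part is at most [p ^ (8 * log2S p)] by the third clause,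
    so [j] lies in the range of the second. If [j > 0], that clause is violated, [p] and [d] being
    coprime divisors of [m]. *)
Lemma not_bad_prime (p m : nat) : prime p -> p %| m -> 0 < m ->
  ~~ bad_prime p m -> logn p m = 1 /\ sylow_forcing m p.
Proof.
move=> p_pr pm m_gt0; rewrite !negb_or -ltnNge => /and3P[not_p2 /hasPn not_has lt_om].
split; first by apply/eqP; rewrite -logn_exact_dvd // /exact_dvd pm.
move=> d d_part d_mod; have p_gt1 := prime_gt1 p_pr.
apply: contraTeq isT => d_neq1.
set l := log2S p in not_has lt_om.
have def_d := divn_eq d p; rewrite d_mod addnC in def_d.
have j_gt0 : 0 < d %/ p.
  by rewrite lt0n; apply: contraNneq d_neq1 => d0; rewrite def_d d0.
have d_le : d <= p ^ (8 * l).
  apply: leq_trans (dvdn_leq (part_gt0 _ _) d_part) _.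
  by rewrite (leq_trans (smooth_part_le (prime_gt0 p_pr) m_gt0)) // leq_exp2l // ltnW.
have j_lt : d %/ p < 2 ^ (8 * l ^ 2).
  apply: (@leq_trans d); first by rewrite ltn_Pdiv // (leq_trans j_gt0) // leq_div.
  have -> : 8 * l ^ 2 = l * (8 * l) by rewrite -mulnn mulnCA.
  by rewrite (leq_trans d_le) // (expnM 2 l) leq_exp2r ?muln_gt0 // ltnW // trunc_log_ltn.
have /not_has : d %/ p \in iota 1 (2 ^ (8 * l ^ 2)).-1.
  by rewrite mem_iota j_gt0 add1n prednK ?expn_gt0.
apply: contraNN => _; rewrite -def_d Gauss_dvd; last first.
  by rewrite prime_coprime // /dvdn d_mod.
by rewrite pm (dvdn_trans d_part) ?dvdn_part.
Qed.



(** Union bound over the primes from [z = 2 ^ i] on; the bounds of [count_bad_prime_le] form a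
    convergent series, so its tail is small. *)
Lemma upper_density_bad_prime (R : realType) (eps : R) : (0 < eps)%R ->
  exists2 z, 0 < z & forall x,
    ((count (fun m => has (fun p => prime p && bad_prime p m) (iota z x))
       (iota 1 x))%:R <= eps * x%:R)%R.
Proof.
move=> eps_gt0.
have [i le_i] : exists i, (10 * ((2 * i%:R ^+ 2 + 8 * i%:R + 12) / 2 ^+ i) <= eps)%R.
  (* For [i = 4 k] ten times the numerator is at most [320 (k + 1)^2 <= eps (k + 1)^3], while
     [2^(4 k) >= (k + 1)^4]. *)
  pose k := Num.bound (320 / eps)%R; exists (4 * k).
  have k_gt : (320 / eps < k%:R)%R.
    by apply: archi_boundP; rewrite divr_ge0 // ltW.
  have le_pow : (((k%:R + 1) ^+ 4 : R) <= 2 ^+ (4 * k))%R.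
    by rewrite mulnC exprM natr1 lerXn2r ?nnegrE ?exprn_ge0 // -natrX ler_nat ltn_expl.
  rewrite mulrA ler_pdivrMr ?exprn_gt0 //.
  apply: le_trans (ler_wpM2l (ltW eps_gt0) le_pow).
  rewrite natrM; have k_ge0 : (0 <= k%:R :> R)%R by [].
  have : (320 < eps * k%:R)%R by rewrite mulrC -ltr_pdivrMr.
  move: (k%:R : R)%R k_ge0 => K K0 h.
  have h1 : (320 * (K + 1) ^+ 2 <= eps * (K + 1) * (K + 1) ^+ 2)%R.
    rewrite ler_wpM2r ?exprn_ge0 ?addr_ge0 //; nra.
  have h2 : (eps * (K + 1) * (K + 1) ^+ 2 <= eps * (K + 1) ^+ 4)%R.
    have -> : (eps * (K + 1) ^+ 4 = eps * (K + 1) * (K + 1) ^+ 2 * (K + 1))%R by ring.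
    rewrite ler_peMr ?lerDr // !mulr_ge0 ?exprn_ge0 ?addr_ge0 //; exact: ltW.
  apply: le_trans (le_trans h1 h2); nra.
exists (2 ^ i) => [|x]; first by rewrite expn_gt0.
set z := 2 ^ i.
pose B p m := prime p && bad_prime p m.
apply: (@le_trans _ _ (\sum_(p <- iota z x) count (B p) (iota 1 x))%:R%R).
  by rewrite ler_nat; exact: count_has_le.
rewrite natr_sum.
have count_B p : ((count (B p) (iota 1 x))%:R
    <= 10 * ((log2S p)%:R ^+ 2 / p%:R ^+ 2) * x%:R :> R)%R.
  rewrite mulrA; have [p_pr|p_npr] := boolP (prime p).
    by rewrite /B p_pr; apply: count_bad_prime_le.
  rewrite /B (negPf p_npr) count_pred0.
  by rewrite !mulr_ge0 ?invr_ge0 ?exprn_ge0.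
apply: le_trans (ler_sum _ (fun p _ => count_B p)) _.
rewrite -mulr_suml -mulr_sumr ler_wpM2r //; apply: le_trans le_i.
rewrite ler_wpM2l //; apply: le_trans (sum_log2S_tail_le R (leq_addr x i)).
have -> : iota z x = index_iota z (z + x) by rewrite /index_iota addKn.
have le_pow : z + x <= 2 ^ (i + x).
  rewrite expnD -/z -[2 ^ x]prednK ?expn_gt0 // mulnS leq_add2l.
  have z_gt0 : 0 < z by rewrite expn_gt0.
  apply: (leq_trans _ (leq_pmull _ z_gt0)).
  by rewrite -ltnS prednK ?expn_gt0 // ltn_expl.
rewrite [leRHS](@big_cat_nat _ _ _ (z + x)) ?leq_addr //= lerDl sumr_ge0 // => p _.
by rewrite divr_ge0 ?exprn_ge0.
Qed.

(** * Real characters and the nonvanishing of L(1, chi) *)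

Local Open Scope ring_scope.

Section RealCharacter.
Variable R : realType.

Record real_character (N : nat) (chi : nat -> R) : Prop := RealCharacter {
  rchar_mul : forall m n, chi (m * n)%N = chi m * chi n;
  rchar_periodic : periodic N chi;
  rchar_unit : forall n, coprime n N -> chi n = 1 \/ chi n = -1;
  rchar_nonunit : forall n, ~~ coprime n N -> chi n = 0 }.

Section Theory.
Variables (N : nat) (chi : nat -> R).
Hypotheses (N_gt0 : (0 < N)%N) (chiP : real_character N chi).

Lemma rchar1 : chi 1 = 1.
Proof.
have := rchar_mul chiP 1 1; rewrite mul1n.
by case: (rchar_unit chiP (coprime1n N)) => -> //; rewrite mulrNN mulr1 => /eqP;
  rewrite eq_sym -addr_eq0 => /eqP h; lra.
Qed.

Lemma rchar_norm_le n : `|chi n| <= 1.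
Proof.
have [co|nco] := boolP (coprime n N).
  by case: (rchar_unit chiP co) => ->; rewrite ?normrN normr1.
by rewrite (rchar_nonunit chiP nco) normr0.
Qed.

Hypothesis chi_nonprincipal : exists a, chi a = -1.

(** Multiplication by [a] with [chi a = -1] permutes the residues and negates the sum. *)
Lemma rchar_sum_period : \sum_(0 <= i < N) chi i = 0.
Proof.
have [a chia] := chi_nonprincipal.
have co_aN : coprime a N.
  apply: contraPT chia => nco; rewrite (rchar_nonunit chiP nco) => /eqP.
  by rewrite eq_sym oppr_eq0 oner_eq0.
rewrite big_mkord; pose h (i : 'I_N) := Ordinal (ltn_pmod (a * i) N_gt0).
have h_inj : injective h.
  move=> i j [] /eqP; wlog le_ij : i j / (i <= j)%N.
    by move=> th; case: (leqP i j) => [/th //|/ltnW le_ji]; rewrite eq_sym => /(th _ _ le_ji).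
  rewrite eq_sym eqn_mod_dvd ?leq_mul // -mulnBr Gauss_dvdr 1?coprime_sym //.
  move=> dvd_N; apply/val_inj/eqP; rewrite eqn_leq le_ij /= -subn_eq0.
  rewrite eqn0Ngt; apply: contraTN dvd_N => gt0; rewrite gtnNdvd //.
  by rewrite ltn_subLR // ltn_addl.
have : \sum_(i < N) chi i = - \sum_(i < N) chi i.
  rewrite [LHS](reindex_inj h_inj) -mulN1r mulr_sumr; apply: eq_bigr => i _ /=.
  by rewrite (periodic_mod (rchar_periodic chiP)) (rchar_mul chiP) chia.
lra.
Qed.

(** Full periods sum to 0, leaving fewer than [N] terms. *)
Lemma rchar_sum_le x : `|\sum_(0 <= i < x) chi i| <= N%:R.
Proof.
have shift y : \sum_(0 <= i < y + N) chi i = \sum_(0 <= i < y) chi i.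
  elim: y => [|y IHy]; first by rewrite rchar_sum_period big_geq.
  by rewrite addSn !big_nat_recr //= IHy (rchar_periodic chiP).
rewrite -(periodic_mod shift) (le_trans (ler_norm_sum _ _ _)) //.
apply: le_trans (ler_sum _ (fun i _ => rchar_norm_le i)) _.
by rewrite sumr_const_nat subn0 ler_nat ltnW // ltn_pmod.
Qed.

Lemma rchar_sum_nat_le M x : (M <= x)%N -> `|\sum_(M <= i < x) chi i| <= 2 * N%:R.
Proof.
move=> le_Mx; have := @big_cat_nat _ _ +%R M 0 x predT chi (leq0n _) le_Mx => /=.
move=> /esym/(canRL (addKr _)) ->.
apply: le_trans (ler_normD _ _) _; rewrite normrN mulr_natl mulr2n lerD //;
  exact: rchar_sum_le.
Qed.

End Theory.

Lemma rchar_mulr N chi psi : real_character N chi -> real_character N psi ->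
  real_character N (fun n => chi n * psi n).
Proof.
move=> chiP psiP; split=> [m n|n|n co|n nco].
- by rewrite (rchar_mul chiP) (rchar_mul psiP) mulrACA.
- by rewrite (rchar_periodic chiP) (rchar_periodic psiP).
- by case: (rchar_unit chiP co) => ->; case: (rchar_unit psiP co) => ->;
    rewrite ?mulrNN ?mulrN ?mulr1; [left|right|right|left].
- by rewrite (rchar_nonunit chiP nco) mul0r.
Qed.

Lemma rchar_principal N : real_character N (fun n => (coprime n N)%:R).
Proof.
split=> [m n|n|n ->|n /negPf -> //]; last by left.
  by rewrite coprimeMl -natrM mulnb.
by rewrite /coprime -gcdn_modl modnDr gcdn_modl.
Qed.

End RealCharacter.

(** * Summation by parts *)

Section Abel.
Variable R : realType.
Implicit Types (a b : nat -> R) (M y : nat) (K : R).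

Lemma summation_by_parts a b M y : (M <= y)%N ->
  \sum_(M <= n < y) a n * b n =
    (\sum_(M <= n < y) a n) * b y
      + \sum_(M <= n < y) (\sum_(M <= i < n.+1) a i) * (b n - b n.+1).
Proof.
move=> le_My; rewrite -(subnKC le_My).
elim: (y - M)%N => [|k IHk]; first by rewrite addn0 !big_geq // mul0r addr0.
rewrite addnS !(big_nat_recr (M + k)) ?leq_addr //= IHk.
ring.
Qed.

Lemma abel_bound a b M y K : (M <= y)%N ->
    (forall x, (M <= x)%N -> `|\sum_(M <= n < x) a n| <= K) ->
  `|\sum_(M <= n < y) a n * b n|
    <= K * (`|b y| + \sum_(M <= n < y) `|b n - b n.+1|).
Proof.
move=> le_My leK; rewrite summation_by_parts // mulrDr mulr_sumr.
apply: le_trans (ler_normD _ _) _; rewrite lerD ?normrM ?ler_wpM2r ?leK //.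
apply: le_trans (ler_norm_sum _ _ _) _; apply: ler_sum_nat => n /andP[le_Mn _].
by rewrite normrM ler_wpM2r // leK // leqW.
Qed.

Lemma abel_bound_monotone a b M y K : (M <= y)%N ->
    (forall x, (M <= x)%N -> `|\sum_(M <= n < x) a n| <= K) ->
    (forall n, (M <= n)%N -> 0 <= b n) ->
    (forall n, (M <= n)%N -> b n.+1 <= b n) ->
  `|\sum_(M <= n < y) a n * b n| <= K * b M.
Proof.
move=> le_My leK b_ge0 b_mono; apply: le_trans (abel_bound b le_My leK) _.
have -> : \sum_(M <= n < y) `|b n - b n.+1| = b M - b y; last first.
  by rewrite ger0_norm ?b_ge0 // addrC subrK.
rewrite -[RHS]opprB -telescope_sumr // -sumrN; apply: eq_big_nat => n /andP[le_Mn _].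
by rewrite ger0_norm ?subr_ge0 ?b_mono // opprB.
Qed.

End Abel.

(** * Divisor sums of a real character and its L-value at 1 *)

Section DivisorSum.
Variables (R : realType) (N : nat) (chi : nat -> R).
Hypotheses (N_gt0 : (0 < N)%N) (chiP : real_character N chi).

(** The convolution of [chi] with 1; its Dirichlet series is [zeta(s) L(s, chi)]. *)
Definition divisor_sum (n : nat) : R := \sum_(1 <= d < n.+1 | (d %| n)%N) chi d.

Lemma dvdn_pfactor_step (p k m d : nat) : prime p -> ~~ (p %| m)%N ->
  (d %| p ^ k * m)%N = (d %| p ^ k.+1 * m)%N && ~~ (p ^ k.+1 %| d)%N.
Proof.
move=> p_pr not_pm; have m_gt0 : (0 < m)%N by case: m not_pm; rewrite ?dvdn0.
have p_gt0 := prime_gt0 p_pr.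
apply/idP/andP => [dvd_d | [dvd_d not_pd]].
  split; first by apply: dvdn_trans dvd_d _; rewrite dvdn_mul // dvdn_exp2l.
  apply: contra not_pm => /dvdn_trans /(_ dvd_d).
  by rewrite expnSr dvdn_pmul2l // expn_gt0 p_gt0.
have d_gt0 : (0 < d)%N by apply: dvdn_gt0 dvd_d; rewrite muln_gt0 expn_gt0 p_gt0.
have [e co_pe def_d] := pfactor_coprime p_pr d_gt0.
rewrite pfactor_dvdn // -leqNgt in not_pd.
have e_dvd : (e %| m)%N.
  have : (e %| p ^ k.+1 * m)%N by rewrite (dvdn_trans _ dvd_d) // def_d dvdn_mulr.
  by rewrite Gauss_dvdr // coprime_sym coprimeXl.
by rewrite def_d mulnC dvdn_mul // dvdn_exp2l.
Qed.

Lemma divisor_sum_pfactorS (p k m : nat) : prime p -> ~~ (p %| m)%N -> (0 < m)%N ->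
  divisor_sum (p ^ k.+1 * m)
    = divisor_sum (p ^ k * m) + chi p ^+ k.+1 * divisor_sum m.
Proof.
move=> p_pr not_pm m_gt0; have p_gt0 := prime_gt0 p_pr.
have q_gt0 i : (0 < p ^ i)%N by rewrite expn_gt0 p_gt0.
rewrite /divisor_sum (bigID (fun d => (p ^ k.+1 %| d)%N)) /= addrC; congr (_ + _).
  rewrite [RHS](@big_nat_widen _ _ _ _ _ (p ^ k.+1 * m).+1); last first.
    by rewrite ltnS leq_mul2r leq_pexp2l ?orbT.
  apply: eq_bigl => d; rewrite -dvdn_pfactor_step //.
  case: (boolP (d %| _)%N) => //= /dvdn_leq; rewrite ltnS => -> //.
  by rewrite muln_gt0 q_gt0.
rewrite big_mkcondl /= (big_multiples (fun d => if (d %| _)%N then chi d else 0)) //.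
rewrite mulKn // -big_mkcond mulr_sumr; apply: eq_big => d.
  by rewrite dvdn_pmul2l.
have chiX i : chi (p ^ i)%N = chi p ^+ i.
  by elim: i => [|i IHi]; rewrite ?(rchar1 chiP) // expnS exprS (rchar_mul chiP) IHi.
by rewrite (rchar_mul chiP) chiX.
Qed.

Lemma divisor_sum_pfactor (p k m : nat) : prime p -> ~~ (p %| m)%N -> (0 < m)%N ->
  divisor_sum (p ^ k * m) = (\sum_(0 <= i < k.+1) chi p ^+ i) * divisor_sum m.
Proof.
move=> p_pr not_pm m_gt0; elim: k => [|k IHk].
  by rewrite mul1n big_nat1 expr0 mul1r.
by rewrite divisor_sum_pfactorS // IHk -mulrDl -big_nat_recr.
Qed.

(** For [chi n] equal to 0 or 1 the sum is 1 or [k + 1]; for [chi n = -1] it is 1 or 0 as [k] is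
    even or odd. *)
Lemma sum_rchar_pow (n k : nat) :
  let s := \sum_(0 <= i < k.+1) chi n ^+ i in 0 <= s /\ (~~ odd k -> 1 <= s).
Proof.
rewrite /=; have [co|nco] := boolP (coprime n N); last first.
  rewrite (rchar_nonunit chiP nco) big_nat_recl // expr0 big1 ?addr0 // => i _.
  by rewrite exprS mul0r.
case: (rchar_unit chiP co) => ->.
  by split=> [|_]; rewrite big_nat_recl // expr0 ?lerDl ?addr_ge0 ?sumr_ge0 // => i _;
    rewrite expr1n.
have -> : \sum_(0 <= i < k.+1) (-1) ^+ i = (~~ odd k)%:R :> R.
  elim: k => [|k IHk]; first by rewrite big_nat1.
  rewrite big_nat_recr // IHk /= negbK -signr_odd /=.
  by case: (odd k); rewrite /= ?expr0 ?expr1 ?add0r ?subrr.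
by case: (odd k).
Qed.

(** By multiplicativity, splitting off the full power of the least prime factor. *)
Lemma divisor_sum_ge0 (n : nat) : (0 < n)%N -> 0 <= divisor_sum n.
Proof.
have [k] := ubnP n; elim: k n => // k IHk n /ltnSE-le_nk n_gt0.
have [n_gt1 | n_le1] := ltnP 1 n; last first.
  have -> : n = 1%N by apply/eqP; rewrite eqn_leq n_le1.
  by rewrite /divisor_sum big_mkcond big_nat1 /= (rchar1 chiP).
have p_pr := pdiv_prime n_gt1; set p := pdiv n in p_pr.
have [m co_pm def_n] := pfactor_coprime p_pr n_gt0.
rewrite prime_coprime // in co_pm.
have m_gt0 : (0 < m)%N by case: m co_pm {def_n} => //; rewrite dvdn0.
rewrite def_n mulnC divisor_sum_pfactor // mulr_ge0 ?IHk //.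
  by case: (sum_rchar_pow p (logn p n)).
apply: leq_trans le_nk; rewrite [leqRHS]def_n ltn_Pmulr // -(exp1n (logn p n)).
by rewrite ltn_exp2r ?prime_gt1 // logn_gt0 mem_primes p_pr n_gt0 pdiv_dvd.
Qed.

(** All exponents in a square are even, so every local factor is at least 1. *)
Lemma divisor_sum_square_ge1 (n : nat) : (0 < n)%N -> 1 <= divisor_sum (n ^ 2).
Proof.
have [k] := ubnP n; elim: k n => // k IHk n /ltnSE-le_nk n_gt0.
have [n_gt1 | n_le1] := ltnP 1 n; last first.
  have -> : n = 1%N by apply/eqP; rewrite eqn_leq n_le1.
  by rewrite /divisor_sum big_mkcond big_nat1 /= (rchar1 chiP).
have p_pr := pdiv_prime n_gt1; set p := pdiv n in p_pr.
have [m co_pm def_n] := pfactor_coprime p_pr n_gt0.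
have not_pm2 : ~~ (p %| m ^ 2)%N by rewrite -prime_coprime // coprimeXr.
rewrite prime_coprime // in co_pm.
have m_gt0 : (0 < m)%N by case: m co_pm {def_n not_pm2} => //; rewrite dvdn0.
rewrite def_n mulnC expnMn -expnM divisor_sum_pfactor ?expn_gt0 ?m_gt0 //.
have [_] := sum_rchar_pow p (logn p n * 2); rewrite oddM andbF => /(_ isT) ge1.
rewrite (le_trans ge1) // ler_peMr ?(le_trans ler01 ge1) // IHk //.
apply: leq_trans le_nk; rewrite [leqRHS]def_n ltn_Pmulr // -(exp1n (logn p n)).
by rewrite ltn_exp2r ?prime_gt1 // logn_gt0 mem_primes p_pr n_gt0 pdiv_dvd.
Qed.

(* If [L(1, chi) = 0], summation by parts shows that the Riesz mean
   [\sum_(n <= X) divisor_sum n * (X - n)] is [O(X^(4/3))] up to logarithms; but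
   it is at least of order [X^(3/2)], because of the squares. *)
Definition riesz (X d : nat) : R := \sum_(1 <= k < X.+1) (X - d * k)%N%:R.

(** Put [n = d k] and exchange the sums. Truncated subtraction kills the terms with [d k > X], so
    [k] may run up to [X]. *)
Lemma sum_divisor_sum_riesz (X : nat) :
  \sum_(1 <= n < X.+1) divisor_sum n * (X - n)%N%:R
    = \sum_(1 <= d < X.+1) chi d * riesz X d.
Proof.
under eq_big_nat => n /andP[n_gt0 le_nX].
  rewrite /divisor_sum (@big_nat_widen _ _ _ _ _ X.+1) // mulr_suml big_mkcond /=.
  under eq_bigr => d _.
    rewrite (_ : _ && _ = (d %| n)%N); last first.
      by case: (boolP (d %| n)%N) => // /dvdn_leq; rewrite ltnS => ->.
    over.
  over.
rewrite exchange_big_nat /=; apply: eq_big_nat => d /andP[d_gt0 le_dX].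
rewrite -big_mkcond (big_multiples (fun n => chi d * (X - n)%N%:R)) // -mulr_sumr.
congr (_ * _); rewrite /riesz [RHS](@big_cat_nat _ _ _ (X %/ d).+1) //=; last first.
  by rewrite ltnS leq_div.
rewrite [X in _ = _ + X]big1_seq ?addr0 // => k; rewrite mem_index_iota => /and3P[_ lt_k _].
by rewrite (_ : (X - d * k = 0)%N) //; apply/eqP; rewrite subn_eq0 ltnW // mulnC -ltn_divLR.
Qed.

(** Keep only the squares [n = a^2] with [a <= Z]: their coefficients are at least 1 and their
    weights at least [X - Z^2]. *)
Lemma sum_divisor_sum_lower (X Z : nat) : (Z ^ 2 <= X)%N ->
  Z%:R * (X%:R - Z%:R ^+ 2) <= \sum_(1 <= n < X.+1) divisor_sum n * (X - n)%N%:R.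
Proof.
move=> le_ZX.
pose F n := divisor_sum n * (X - n)%N%:R.
have F_ge0 n : (0 < n)%N -> 0 <= F n by move=> n_gt0; rewrite mulr_ge0 ?divisor_sum_ge0.
have squares_le z : \sum_(1 <= a < z.+1) F (a ^ 2)%N <= \sum_(1 <= n < (z ^ 2).+1) F n.
  elim: z => [|z IHz]; first by rewrite !big_geq.
  have lt_sq : (z ^ 2 < z.+1 ^ 2)%N by rewrite ltn_exp2r.
  rewrite big_nat_recr //= [leRHS]big_nat_recr ?expn_gt0 //= lerD2r.
  apply: le_trans IHz _; rewrite [leRHS](@big_cat_nat _ _ _ (z ^ 2).+1) //=.
  rewrite lerDl big_seq sumr_ge0 // => n; rewrite mem_index_iota => /andP[lt_n _].
  by rewrite F_ge0 // (leq_trans _ lt_n).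
apply: (@le_trans _ _ (\sum_(1 <= n < (Z ^ 2).+1) F n)); last first.
  rewrite [leRHS](@big_cat_nat _ _ _ (Z ^ 2).+1) //= lerDl big_seq sumr_ge0 // => n.
  by rewrite mem_index_iota => /andP[lt_n _]; rewrite F_ge0 // (leq_trans _ lt_n).
apply: le_trans (squares_le Z).
have <- : \sum_(1 <= a < Z.+1) (X%:R - Z%:R ^+ 2) = Z%:R * (X%:R - Z%:R ^+ 2) :> R.
  by rewrite sumr_const_nat subSS subn0 -[LHS]mulr_natl.
apply: ler_sum_nat => a /andP[a_gt0 le_aZ]; rewrite /F.
have le_a2 : (a ^ 2 <= Z ^ 2)%N by rewrite leq_exp2r.
have le_X : X%:R - Z%:R ^+ 2 <= (X - a ^ 2)%N%:R :> R.
  by rewrite natrB ?(leq_trans le_a2) // lerB // -natrX ler_nat.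
by apply: (le_trans le_X); rewrite ler_peMl ?divisor_sum_square_ge1.
Qed.

(** The truncated difference is at least the true one, so the sum may be cut off at any [k], in
    particular at the quotient belonging to a neighbouring [d]. *)
Lemma riesz_ge (X d k : nat) : (k <= X)%N ->
  k%:R * X%:R - d%:R * (k%:R * (k%:R + 1)) / 2 <= riesz X d.
Proof.
move=> le_kX.
apply: (@le_trans _ _ (\sum_(1 <= i < k.+1) (X - d * i)%N%:R)); last first.
  by rewrite /riesz [leRHS](@big_cat_nat _ _ _ k.+1) //= lerDl sumr_ge0.
have <- : \sum_(1 <= i < k.+1) (X%:R - d%:R * i%:R)
    = k%:R * X%:R - d%:R * (k%:R * (k%:R + 1)) / 2 :> R.
  elim: k {le_kX} => [|k IHk]; first by rewrite big_geq // !mul0r mulr0 mul0r subrr.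
  by rewrite big_nat_recr //= IHk -natr1; field.
apply: ler_sum_nat => i _; rewrite -natrM lerBlDr -natrD ler_nat; lia.
Qed.

Lemma riesz_eq (X d : nat) : (0 < d)%N ->
  riesz X d = (X %/ d)%:R * X%:R
    - d%:R * ((X %/ d)%:R * ((X %/ d)%:R + 1)) / 2.
Proof.
move=> d_gt0; rewrite /riesz (@big_cat_nat _ _ _ (X %/ d).+1) //=; last first.
  by rewrite ltnS leq_div.
rewrite [X in _ + X]big1_seq ?addr0 => [|k]; last first.
  rewrite mem_index_iota => /and3P[_ lt_k _].
  rewrite (_ : (X - d * k = 0)%N) //; apply/eqP; rewrite subn_eq0 ltnW // mulnC.
  by rewrite -ltn_divLR.
have : (X %/ d * d <= X)%N := leq_trunc_div X d.
elim: (X %/ d)%N => [|k IHk] le_kd; first by rewrite big_geq // !mul0r mulr0 mul0r subrr.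
rewrite big_nat_recr //= IHk; last by rewrite (leq_trans _ le_kd) // leq_mul2r leqnSn orbT.
by rewrite natrB mulnC // natrM -natr1; field.
Qed.

(** The main term [X^2 / (2 d)] is the integral of [X - d t] for [t] from 0 to [X / d], with
    [riesz X d] as a Riemann sum. *)
Definition riesz_err (X d : nat) : R := X%:R ^+ 2 / (2 * d%:R) - riesz X d.

(** For [X = m d + r] with [r < d], the error is [(r^2 + d^2 m) / (2 d)]. *)
Lemma riesz_err_bound (X d : nat) : (0 < d <= X)%N -> 0 <= riesz_err X d <= X%:R.
Proof.
move=> /andP[d_gt0 le_dX]; rewrite /riesz_err riesz_eq //.
have := divn_eq X d; have := ltn_pmod X d_gt0; have := leq_div X d.
move: (X %/ d)%N (X %% d)%N => m r le_mX lt_rd /(congr1 (fun n => n%:R : R)).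
rewrite natrD natrM.
have d0 : 0 < d%:R :> R by rewrite ltr0n.
have r0 : 0 <= r%:R :> R by [].
have m0 : 0 <= m%:R :> R by [].
have : r%:R <= d%:R :> R by rewrite ler_nat ltnW.
have : d%:R <= X%:R :> R by rewrite ler_nat.
have : m%:R <= X%:R :> R by rewrite ler_nat.
move: (X%:R : R) (d%:R : R) (m%:R : R) (r%:R : R) d0 r0 m0 => x D M r' D0 r0 M0 hM hD hr def_x.
have -> : x ^+ 2 / (2 * D) - (M * x - D * (M * (M + 1)) / 2) = (r' ^+ 2 + D ^+ 2 * M) / (2 * D).
  by rewrite def_x; field; rewrite gt_eqF.
have D0' := ltW D0.
apply/andP; split; first by rewrite divr_ge0 ?addr_ge0 ?mulr_ge0 ?exprn_ge0.
rewrite ler_pdivrMr ?mulr_gt0 //.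
have h1 : r' ^+ 2 <= D * x.
  by rewrite expr2 ler_pM // (le_trans hr).
have h2 : D * (D * M) <= D * x by rewrite ler_wpM2l // def_x mulrC lerDl.
by rewrite expr2; lra.
Qed.

(** Let [m = X %/ d] and [m' = X %/ d.+1]. Cutting each sum off at the quotient of the other puts
    the difference of the [riesz] values between [m' (m' + 1) / 2] and [m (m + 1) / 2]. The main
    terms differ by [y y' / 2] with [y = X / d] and [y' = X / (d + 1)], which is close to both. *)
Lemma riesz_err_diff (X d : nat) : (0 < d)%N -> (0 < X)%N ->
  `|riesz_err X d - riesz_err X d.+1| <= X%:R ^+ 2 / d%:R ^+ 3 + X%:R / d%:R.
Proof.
move=> d_gt0 X_gt0; rewrite /riesz_err.
have le1 := riesz_ge d.+1 (leq_div X d); have le2 := riesz_ge d (leq_div X d.+1).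
have eq1 := riesz_eq X d_gt0; have eq2 := riesz_eq X (ltn0Sn d).
have := leq_trunc_div X d; rewrite -(ler_nat R) natrM.
have := ltn_ceil X (ltn0Sn d); rewrite -(ltr_nat R) natrM -natr1.
move: le1 le2 eq1 eq2.
move: (riesz X d) (riesz X d.+1) => T T'.
have d0 : 1 <= d%:R :> R by rewrite ler1n.
have x0 : 0 < X%:R :> R by rewrite ltr0n.
have m0 : 0 <= (X %/ d)%:R :> R by [].
have m0' : 0 <= (X %/ d.+1)%:R :> R by [].
rewrite -[d.+1%:R]natr1.
move: (X%:R : R) (d%:R : R) ((X %/ d)%:R : R) ((X %/ d.+1)%:R : R) d0 x0 m0 m0'.
move=> x D m m' D1 x0 m0 m0' le1 le2 eq1 eq2 gt_m' le_m.
have D0 : 0 < D by lra.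
have hi : T - T' <= m * (m + 1) / 2 by lra.
have lo : m' * (m' + 1) / 2 <= T - T' by lra.
pose y := x / D; pose y' := x / (D + 1).
have def_x : x = y * D by rewrite /y divfK // gt_eqF.
have def_x' : x = y' * (D + 1) by rewrite /y' divfK // gt_eqF //; lra.
have y0 : 0 < y by rewrite divr_gt0.
have y0' : 0 < y' by rewrite divr_gt0 //; lra.
have m_le : m <= y by rewrite ler_pdivlMr.
have m_ge : y' <= m' + 1 by rewrite ler_pdivrMr ?ltW //; lra.
have hi' : T - T' <= y * (y + 1) / 2.
  apply: (le_trans hi); rewrite ler_pM2r ?invr_gt0 //; nra.
have lo' : y' * (y' - 1) / 2 <= T - T'.
  apply: le_trans lo; rewrite ler_pM2r ?invr_gt0 //; nra.
have defA : x ^+ 2 / (2 * D) - x ^+ 2 / (2 * (D + 1)) = y * y' / 2.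
  by rewrite /y /y'; field; rewrite !gt_eqF //; lra.
have rhs1 : x ^+ 2 / D ^+ 3 = y ^+ 2 / D by rewrite /y; field; rewrite gt_eqF.
have yy' : y' = y - y / (D + 1) by rewrite /y /y'; field; rewrite !gt_eqF //; lra.
have yy2 : y = y' + y' / D by rewrite /y /y'; field; rewrite !gt_eqF //; lra.
have yD1 : y / (D + 1) <= y / D by rewrite ler_pM2l // lef_pV2 ?posrE //; lra.
have h1 : y * (y / (D + 1)) <= y ^+ 2 / D by rewrite expr2 -mulrA ler_pM2l.
have le_y'y : y' <= y by rewrite yy' gerBl divr_ge0 // ?ltW //; lra.
have h2 : y' * (y' / D) <= y ^+ 2 / D.
  by rewrite mulrA -expr2 ler_pM2r ?invr_gt0 // lerXn2r ?nnegrE //; exact: ltW.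
have h0 : 0 <= y ^+ 2 / D by rewrite divr_ge0 ?exprn_ge0 ?ltW.
have eA : y * y' = y ^+ 2 - y * (y / (D + 1)) by rewrite yy'; ring.
have eB : y * y' = y' ^+ 2 + y' * (y' / D) by rewrite {1}yy2; ring.
have eC : y * (y + 1) = y ^+ 2 + y by ring.
have eD : y' * (y' - 1) = y' ^+ 2 - y' by ring.
rewrite rhs1 -/y ler_norml; move: h1 h2 hi' lo' eA eB.
rewrite eC eD (_ : _ - _ - _ = y * y' / 2 - (T - T')); last by rewrite -defA; ring.
move=> h1 h2 hi' lo' eA eB; apply/andP; split; lra.
Qed.

Lemma sum_inv_cube_le (D X : nat) : (0 < D)%N ->
  \sum_(D <= d < X) (d%:R ^+ 3)^-1 <= 2 / D%:R ^+ 2 :> R.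
Proof.
move=> D_gt0; have [le_DX | /ltnW le_XD] := leqP D X; last first.
  by rewrite big_geq // divr_ge0 ?exprn_ge0.
pose v (d : nat) : R := 2 / d%:R ^+ 2.
suff : \sum_(D <= d < X) (d%:R ^+ 3)^-1 <= v D - v X.
  by move=> /le_trans; apply; rewrite gerBl divr_ge0 ?exprn_ge0.
rewrite -[v D - v X]opprB -telescope_sumr // -sumrN; apply: ler_sum_nat => d /andP[le_Dd _].
have d1 : 1 <= d%:R :> R by rewrite ler1n (leq_trans D_gt0).
rewrite /v -[d.+1%:R]natr1 opprB; move: (d%:R : R) d1 => x x1.
have -> : 2 / x ^+ 2 - 2 / (x + 1) ^+ 2 = (x ^+ 3)^-1 * (2 * x * (2 * x + 1) / (x + 1) ^+ 2).
  by field; rewrite !gt_eqF //; lra.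
rewrite ler_peMr ?invr_ge0 ?exprn_ge0 //; first by lra.
rewrite ler_pdivlMr ?exprn_gt0 //; first by nra.
by lra.
Qed.

Hypothesis chi_nonprincipal : exists a, chi a = -1.

(** Below [D] each error is at most [X]. From [D] on, Abel summation pairs the bounded character
    sums with the variation of [riesz_err]. *)
Lemma sum_rchar_riesz_err_le (D X : nat) : (0 < D <= X)%N ->
  `|\sum_(1 <= d < X.+1) chi d * riesz_err X d|
    <= D%:R * X%:R
       + 2 * N%:R * (X%:R + (2 * X%:R ^+ 2 / D%:R ^+ 2
                             + X%:R * \sum_(1 <= d < X.+1) d%:R^-1)).
Proof.
move=> /andP[D_gt0 le_DX]; have X_gt0 := leq_trans D_gt0 le_DX.
rewrite (@big_cat_nat _ _ _ D) //=; last exact: leqW.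
apply: le_trans (ler_normD _ _) _; apply: lerD.
  apply: le_trans (ler_norm_sum _ _ _) _.
  apply: (@le_trans _ _ (\sum_(1 <= d < D) X%:R)).
    apply: ler_sum_nat => d /andP[d_gt0 lt_dD].
    have /andP[e0 eX] : 0 <= riesz_err X d <= X%:R.
      by rewrite riesz_err_bound // d_gt0 (leq_trans (ltnW lt_dD)).
    by rewrite normrM (ger0_norm e0) (le_trans _ eX) // ler_piMl // (rchar_norm_le chiP).
  by rewrite sumr_const_nat -[leLHS]mulr_natl ler_wpM2r // ler_nat leq_subr.
have bnd x : (D <= x)%N -> `|\sum_(D <= n < x) chi n| <= 2 * N%:R.
  exact: rchar_sum_nat_le.
apply: le_trans (abel_bound (riesz_err X) (leqW le_DX) bnd) _.
rewrite ler_wpM2l ?mulr_ge0 // lerD //.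
  (* The boundary term sits at [d = X + 1], where [riesz] vanishes. *)
  rewrite /riesz_err riesz_eq // divn_small // !mul0r mulr0 mul0r !subr0.
  rewrite ger0_norm ?divr_ge0 ?exprn_ge0 ?mulr_ge0 // ler_pdivrMr ?mulr_gt0 ?ltr0n //.
  rewrite expr2 ler_wpM2l // -natrM ler_nat; lia.
apply: (@le_trans _ _ (\sum_(D <= d < X.+1) (X%:R ^+ 2 / d%:R ^+ 3 + X%:R / d%:R))).
  apply: ler_sum_nat => d /andP[le_Dd _].
  by rewrite riesz_err_diff // (leq_trans D_gt0).
rewrite big_split /= -!mulr_sumr lerD //.
  have -> : 2 * X%:R ^+ 2 / D%:R ^+ 2 = X%:R ^+ 2 * (2 / D%:R ^+ 2) :> R.
    by rewrite mulrA [_ * 2]mulrC.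
  by rewrite ler_wpM2l ?exprn_ge0 // sum_inv_cube_le.
rewrite ler_wpM2l // [leRHS](@big_cat_nat _ _ _ D) //=; last exact: leqW.
by rewrite lerDr sumr_ge0 // => d _; rewrite invr_ge0.
Qed.

(** The hypothesis identifies [ell] with [L(1, chi)]. If it were 0, the partial sum up to [X] would
    be at most [2 N / (X + 1)], and the Riesz mean would fall below its lower bound. *)
Lemma rchar_L1_neq0 (ell : R) :
    (forall x, `|ell - \sum_(1 <= n < x.+1) chi n / n%:R| <= 2 * N%:R / x.+1%:R) ->
  ell != 0.
Proof.
move=> ellP; apply/eqP=> ell0.
have N1 : 1 <= N%:R :> R by rewrite ler1n.
(* With [Z = t^3] and [D = t^2] the lower bound is [3 t^9] and the upper one [(148 N + 4) t^8],
   while [t > j]. A power of 2 suits the dyadic bound on the harmonic sum. *)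
pose j := (148 * N + 4)%N; pose t := (2 ^ j)%N; pose X := (4 * t ^ 6)%N.
have t_gt0 : (0 < t)%N by rewrite expn_gt0.
have t1 : 1 <= t%:R :> R by rewrite ler1n.
have lt_jt : (j < t)%N by rewrite ltn_expl.
pose Z := (t ^ 3)%N; pose D := (t ^ 2)%N.
have defX : X%:R = 4 * t%:R ^+ 6 :> R by rewrite natrM natrX.
have lower : Z%:R * (X%:R - Z%:R ^+ 2) <= \sum_(1 <= n < X.+1) divisor_sum n * (X - n)%N%:R.
  by apply: sum_divisor_sum_lower; rewrite -expnM leq_pmull.
rewrite sum_divisor_sum_riesz in lower.
have split_sum : \sum_(1 <= d < X.+1) chi d * riesz X d
    = X%:R ^+ 2 / 2 * (\sum_(1 <= d < X.+1) chi d / d%:R)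
      - \sum_(1 <= d < X.+1) chi d * riesz_err X d.
  rewrite mulr_sumr -sumrB; apply: eq_big_nat => d /andP[d_gt0 _].
  rewrite /riesz_err; field; by rewrite pnatr_eq0 -lt0n.
have main_le : X%:R ^+ 2 / 2 * (\sum_(1 <= d < X.+1) chi d / d%:R) <= N%:R * X%:R.
  have := ellP X; rewrite ell0 sub0r normrN => /(le_trans (ler_norm _)).
  rewrite ler_pdivlMr ?ltr0n // -natr1; move: (\sum_(_ <= _ < _) _) => S hS.
  have X1 : 1 <= X%:R :> R by rewrite defX; have := exprn_ege1 6 t1; lra.
  have [S0|/ltW S0] := leP S 0; nra.
have le_DX : (0 < D <= X)%N.
  rewrite expn_gt0 t_gt0 /= (leq_trans (_ : _ <= t ^ 6)%N) ?leq_pmull //.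
  by rewrite leq_pexp2l.
have err := sum_rchar_riesz_err_le le_DX.
have harm : \sum_(1 <= d < X.+1) d%:R^-1 <= 9 * t%:R :> R.
  apply: (@le_trans _ _ (6 * j + 3)%:R).
    apply: le_trans (harmonic_pow2_le R _).
    have le_X : (X.+1 <= 2 ^ (6 * j + 3))%N.
      have t6_gt0 : (0 < t ^ 6)%N by rewrite expn_gt0 t_gt0.
      have -> : (2 ^ (6 * j + 3) = 8 * t ^ 6)%N by rewrite expnD mulnC [(6 * j)%N]mulnC expnM.
      rewrite /X; lia.
    by rewrite [leRHS](@big_cat_nat _ _ _ X.+1) //= lerDl sumr_ge0 // => d _; rewrite invr_ge0.
  by rewrite -natrM ler_nat; lia.
rewrite split_sum in lower; move: lower main_le err harm.
move: (X%:R ^+ 2 / 2 * (\sum_(1 <= d < X.+1) chi d / d%:R))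
  (\sum_(1 <= d < X.+1) chi d * riesz_err X d)
  (\sum_(1 <= d < X.+1) (d%:R^-1 : R)) => A B H.
have defZ : Z%:R = t%:R ^+ 3 :> R by rewrite natrX.
have defD : D%:R = t%:R ^+ 2 :> R by rewrite natrX.
rewrite defZ defD defX => lower main_le err harm.
have t_big : 148 * N%:R + 4 < t%:R :> R by rewrite -natrM -natrD ltr_nat.
have eD : 2 * (4 * t%:R ^+ 6) ^+ 2 / (t%:R ^+ 2) ^+ 2 = 32 * t%:R ^+ 8 :> R.
  by field; rewrite gt_eqF //; lra.
rewrite eD in err.
have hB : - B <= `|B| by rewrite -normrN ler_norm.
move: (t%:R : R) t1 t_big lower main_le err harm => u u1 u_big lower main_le err harm.
have u8 : 0 < u ^+ 8 by rewrite exprn_gt0 //; lra.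
have u68 : u ^+ 6 <= u ^+ 8 by rewrite ler_weXn2l.
have u78 : u ^+ 7 <= u ^+ 8 by rewrite ler_weXn2l.
have e1 : u ^+ 3 * (4 * u ^+ 6 - (u ^+ 3) ^+ 2) = 3 * u * u ^+ 8 by ring.
have e2 : u ^+ 2 * (4 * u ^+ 6) = 4 * u ^+ 8 by ring.
have h3 : 4 * u ^+ 6 * H <= 36 * u ^+ 7.
  apply: le_trans (ler_wpM2l _ harm) _; first by rewrite mulr_ge0 ?exprn_ge0 //; lra.
  by rewrite le_eqVlt; apply/orP; left; apply/eqP; ring.
have h4 : 2 * N%:R * (4 * u ^+ 6 + (32 * u ^+ 8 + 4 * u ^+ 6 * H)) <= 2 * N%:R * (72 * u ^+ 8).
  by rewrite ler_wpM2l ?mulr_ge0 //; lra.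
have h5 : N%:R * (4 * u ^+ 6) <= N%:R * (4 * u ^+ 8) by rewrite ler_wpM2l //; lra.
have h6 : (148 * N%:R + 4) * u ^+ 8 < u * u ^+ 8 by rewrite ltr_pM2r.
have h7 : 0 < u * u ^+ 8 by rewrite mulr_gt0 //; lra.
rewrite e1 e2 in lower err; lra.
Qed.

End DivisorSum.

(** * Primes with prescribed quadratic characters *)

From mathcomp Require Import finmap mathcomp_extra boolp classical_sets functions.
From mathcomp Require Import cardinality topology normedtype sequences exp.

Import numFieldNormedType.Exports.

Local Open Scope classical_set_scope.

Section Limits.
Variable R : realType.

(** [L] is the supremum of the [S M - b M]; every [S y + b y] is an upper bound of these. *)
Lemma bounded_tail_limit (S b : nat -> R) :
    (forall M y, (M <= y)%N -> `|S y - S M| <= b M) ->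
  exists L, forall M, `|L - S M| <= b M.
Proof.
move=> tailS; pose E := [set S M - b M | M in [set: nat]].
have b_ge0 M : 0 <= b M := le_trans (normr_ge0 _) (tailS M M (leqnn M)).
have le_SS M y : S M - b M <= S y + b y.
  case: (leqP M y) => [le_My|/ltnW le_yM].
    by have := tailS _ _ le_My; rewrite ler_norml; have := b_ge0 y; lra.
  by have := tailS _ _ le_yM; rewrite ler_norml; have := b_ge0 M; lra.
have ubE y : ubound E (S y + b y) by move=> _ [M _ <-]; exact: le_SS.
exists (sup E) => M; rewrite ler_norml; apply/andP; split.
  rewrite lerBrDr addrC; apply: ub_le_sup; last by exists M.
  by exists (S 0%N + b 0%N); exact: ubE.
by rewrite lerBlDr addrC ge_sup //; exists (S 0%N - b 0%N), 0%N.
Qed.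

End Limits.

(** * The weights of an L-series at [1 + e] *)

Section Weight.
Variable R : realType.
Implicit Types (e : R) (m n M y : nat).

(* [n ^ (- e)] and [n ^ (- 1 - e)] for [n > 0]; [vpow e 0 = 1] as [ln 0 = 0]. *)
Definition vpow e n : R := expR (- (e * ln n%:R)).
Definition wpow e n : R := n%:R^-1 * vpow e n.

Lemma vpow_gt0 e n : 0 < vpow e n. Proof. exact: expR_gt0. Qed.

Lemma wpow_ge0 e n : 0 <= wpow e n.
Proof. by rewrite mulr_ge0 ?invr_ge0 // ltW // vpow_gt0. Qed.

Lemma vpowM e m n : (0 < m)%N -> (0 < n)%N -> vpow e (m * n) = vpow e m * vpow e n.
Proof.
move=> m_gt0 n_gt0; rewrite /vpow natrM lnM ?posrE ?ltr0n // mulrDr opprD.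
exact: expRD.
Qed.

Lemma wpowM e m n : (0 < m)%N -> (0 < n)%N -> wpow e (m * n) = wpow e m * wpow e n.
Proof.
by move=> m_gt0 n_gt0; rewrite /wpow vpowM // natrM invfM mulrACA.
Qed.

Lemma wpow1 e : wpow e 1 = 1.
Proof. by rewrite /wpow /vpow ln1 mulr0 oppr0 expR0 invr1 mulr1. Qed.

Lemma vpow_le1 e n : 0 <= e -> vpow e n <= 1.
Proof.
move=> e_ge0; rewrite /vpow -[leRHS]expR0 ler_expR oppr_le0 mulr_ge0 //.
by case: n => [|n]; [rewrite ln0 | rewrite ln_ge0 // ler1n].
Qed.

Lemma wpow_le e n : 0 <= e -> wpow e n <= n%:R^-1.
Proof. by move=> e_ge0; rewrite ler_piMr ?invr_ge0 // vpow_le1. Qed.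

Lemma vpow_noninc e m n : 0 <= e -> (0 < m <= n)%N -> vpow e n <= vpow e m.
Proof.
move=> e_ge0 /andP[m_gt0 le_mn]; rewrite ler_expR lerN2 ler_wpM2l //.
by rewrite ler_ln ?posrE ?ltr0n ?ler_nat // (leq_trans m_gt0).
Qed.

Lemma wpow_noninc e n : 0 <= e -> (0 < n)%N -> wpow e n.+1 <= wpow e n.
Proof.
move=> e_ge0 n_gt0; rewrite ler_pM ?invr_ge0 ?(ltW (vpow_gt0 _ _)) //.
  by rewrite lef_pV2 ?posrE ?ltr0n // ler_nat.
by rewrite vpow_noninc // n_gt0 leqnSn.
Qed.

(** From [expR x >= 1 + x] and [ln n <= n]. It controls a fixed partial sum as [e] tends to 0. *)
Lemma wpow_ge e n : 0 <= e -> (0 < n)%N -> n%:R^-1 - e <= wpow e n.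
Proof.
move=> e_ge0 n_gt0; have n0 : 0 < n%:R :> R by rewrite ltr0n.
have ln_le : ln n%:R <= n%:R :> R by rewrite ltW // ln_sublinear.
have h : 1 - e * n%:R <= vpow e n.
  apply: le_trans (expR_ge1Dx _); rewrite lerD2l lerN2 ler_wpM2l //.
have -> : n%:R^-1 - e = n%:R^-1 * (1 - e * n%:R).
  by field; rewrite gt_eqF.
by rewrite ler_wpM2l // invr_ge0 ltW.
Qed.

(** The integral comparison for the tail, from [expR x >= 1 + x] and
    [ln (n + 1) - ln n >= 1 / (n + 1)]. *)
Lemma wpow_telescope e n : 0 < e -> (0 < n)%N ->
  wpow e n.+1 <= e^-1 * (vpow e n - vpow e n.+1).
Proof.
move=> e_gt0 n_gt0; rewrite ler_pdivlMl //.
have n0 : 0 < n%:R :> R by rewrite ltr0n.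
have n1 : 0 < n.+1%:R :> R by rewrite ltr0n.
have ln_diff : n.+1%:R^-1 <= ln n.+1%:R - ln n%:R :> R.
  rewrite -opprB -ln_div ?posrE // lerNr.
  have -> : n%:R / n.+1%:R = 1 + - n.+1%:R^-1 :> R.
    by rewrite -natr1; field; rewrite natr1 gt_eqF.
  by rewrite le_ln1Dx // ltrN2 invf_lt1 // ltr1n.
have step : vpow e n.+1 * (1 + e * n.+1%:R^-1) <= vpow e n.
  have -> : vpow e n = vpow e n.+1 * expR (e * (ln n.+1%:R - ln n%:R)).
    by rewrite /vpow -expRD; congr expR; ring.
  rewrite ler_wpM2l ?(ltW (vpow_gt0 _ _)) //; apply: le_trans (expR_ge1Dx _).
  by rewrite lerD2l ler_wpM2l // ltW.
move: step; rewrite /wpow mulrDr mulr1. move: (n.+1%:R^-1) => z; lra.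
Qed.

Lemma sum_wpow_tail_le e M y : 0 < e -> (0 < M)%N ->
  \sum_(M.+1 <= n < y.+1) wpow e n <= e^-1 * vpow e M.
Proof.
move=> e_gt0 M_gt0; have ei : 0 < e^-1 by rewrite invr_gt0.
have [le_My|lt_yM] := leqP M y; last first.
  by rewrite big_geq ?ltnS 1?ltnW // mulr_ge0 ?ltW // vpow_gt0.
rewrite big_add1 /=.
apply: (@le_trans _ _ (\sum_(M <= n < y) (e^-1 * (vpow e n - vpow e n.+1)))).
  by apply: ler_sum_nat => n /andP[le_Mn _]; rewrite wpow_telescope // (leq_trans M_gt0).
rewrite -mulr_sumr ler_pM2l //.
have -> : \sum_(M <= n < y) (vpow e n - vpow e n.+1) = vpow e M - vpow e y.
  rewrite -[RHS]opprB -telescope_sumr // -sumrN.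
  by apply: eq_bigr => n _; rewrite opprB.
by rewrite gerBl ltW // vpow_gt0.
Qed.

Lemma vpow_cvg0 e : 0 < e -> vpow e @ \oo --> 0.
Proof.
move=> e_gt0; apply/cvgrPdist_le => eps eps_gt0.
have [k le_k] : exists k : nat, expR (- (e^-1 * ln eps)) <= k%:R.
  by exists (Num.bound (expR (- (e^-1 * ln eps)))); rewrite ltW // archi_boundP ?expR_ge0.
exists k.+1 => //= n lt_kn.
rewrite sub0r normrN ger0_norm ?(ltW (vpow_gt0 _ _)) // -[leRHS]lnK ?posrE // ler_expR.
have : - (e^-1 * ln eps) <= ln n%:R.
  rewrite -ler_expR lnK ?posrE ?ltr0n ?(leq_trans _ lt_kn) //.
  by rewrite (le_trans le_k) // ler_nat ltnW.
rewrite lerNl -ler_pdivrMl ?invr_gt0 // invrK mulrN //.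
Qed.

End Weight.

(** * Euler products by sieving *)

Section EulerProduct.
Variables (R : realType) (N : nat) (chi : nat -> R).
Hypotheses (N_gt0 : (0 < N)%N) (chiP : real_character N chi).
Variable e : R.
Hypothesis e_gt0 : 0 < e.

Let f n := chi n * wpow e n.

Let fM m n : (0 < m)%N -> (0 < n)%N -> f (m * n) = f m * f n.
Proof. by move=> m_gt0 n_gt0; rewrite /f (rchar_mul chiP) wpowM // mulrACA. Qed.

Let norm_f_le n : `|f n| <= wpow e n.
Proof.
rewrite /f normrM (ger0_norm (wpow_ge0 e n)) ler_piMl ?wpow_ge0 //.
exact: rchar_norm_le chiP n.
Qed.

Definition coprime_to (P : seq nat) (m : nat) : bool :=
  all (fun p => ~~ (p %| m)%N) P.

Definition sieved_sum (P : seq nat) (y : nat) : R :=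
  \sum_(1 <= m < y.+1 | coprime_to P m) (chi m * wpow e m).

(** One step of the sieve: the multiples of [p] coprime to [P] are [p] times the integers coprime to
    [P]. *)
Lemma sieved_sum_cons p P y : prime p -> p \notin P -> all prime P ->
  sieved_sum (p :: P) y = sieved_sum P y - f p * sieved_sum P (y %/ p).
Proof.
move=> p_pr pP prP; have p_gt0 := prime_gt0 p_pr.
rewrite /sieved_sum [X in _ = X - _](bigID (fun m => (p %| m)%N)) /=.
rewrite [\sum_(1 <= m < y.+1 | _ && (p %| m)%N) _]big_mkcondl /=.
rewrite (big_multiples (fun m => if coprime_to P m then f m else 0)) // addrC mulr_sumr.
rewrite [X in _ + X - _](_ : _ = \sum_(1 <= m < (y %/ p).+1 | coprime_to P m) f p * f m); last first.
  rewrite [RHS]big_mkcond; apply: eq_big_nat => m /andP[m_gt0 _].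
  rewrite fM // (_ : coprime_to P (p * m) = coprime_to P m) //.
  apply: eq_in_all => q qP; have q_pr := allP prP q qP.
  rewrite Euclid_dvdM // dvdn_prime2 // negb_or.
  by rewrite (_ : q != p) //; apply: contraNneq pP => <-.
by rewrite addrK; apply: eq_bigl => m /=; rewrite andbC.
Qed.

Lemma sieved_sum_cvg (P : seq nat) (L : R) : uniq P -> all prime P ->
    sieved_sum [::] @ \oo --> L ->
  sieved_sum P @ \oo --> L * \prod_(p <- P) (1 - chi p * wpow e p).
Proof.
move=> + + cvgL; elim: P => [|p P IHP] /=; first by rewrite big_nil mulr1.
case/andP=> pP uniqP /andP[p_pr prP]; have {}IHP := IHP uniqP prP.
rewrite (_ : sieved_sum (p :: P) =
    (fun y => sieved_sum P y - f p * sieved_sum P (y %/ p)%N)); last first.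
  by apply/funext => y; rewrite sieved_sum_cons.
rewrite big_cons (_ : L * _ = L * \prod_(q <- P) (1 - f q)
    - f p * (L * \prod_(q <- P) (1 - f q))); last by rewrite /f; ring.
apply: cvgB => //; apply: cvgMl_tmp.
exact: cvg_comp (cvg_divnr p (prime_gt0 p_pr)) IHP.
Qed.

Definition primes_upto (x : nat) : seq nat := [seq p <- iota 0 x.+1 | prime p].

(** Only 1 and integers above [x] survive the sieve by all primes up to [x]. *)
Lemma sieved_sum_primes_upto x y : (0 < x <= y)%N ->
  `|sieved_sum (primes_upto x) y - 1| <= e^-1 * vpow e x.
Proof.
case/andP=> x_gt0 le_xy; apply: le_trans (sum_wpow_tail_le y e_gt0 x_gt0).
rewrite /sieved_sum big_mkcond /= (@big_cat_nat _ _ _ x.+1) //=.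
have -> : \sum_(1 <= m < x.+1) (if coprime_to (primes_upto x) m then f m else 0) = 1.
  rewrite big_ltn // big1_seq => [|m]; last first.
    rewrite mem_index_iota => /and3P[_ m_gt1 le_mx]; case: ifP => // /allP.
    move=> /(_ (pdiv m)); rewrite pdiv_dvd mem_filter pdiv_prime // mem_iota add0n.
    by rewrite ltnS (leq_trans (pdiv_leq (ltnW m_gt1))) //= => /(_ isT).
  rewrite addr0 /f (rchar1 chiP) wpow1 mulr1 ifT //; apply/allP=> p.
  by rewrite mem_filter dvdn1 => /andP[p_pr _]; rewrite gtn_eqF // prime_gt1.
rewrite addrAC subrr add0r; apply: le_trans (ler_norm_sum _ _ _) _; apply: ler_sum => m _.
by case: ifP => _; rewrite ?normr0 ?wpow_ge0 // norm_f_le.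
Qed.

(** Sieving by the primes up to [x] multiplies the limit [L] by their Euler factors, and the result
    is within [e^-1 * vpow e x] of 1. *)
Lemma lseries_limit : exists L,
  [/\ 0 < L, forall M, (0 < M)%N -> `|L - sieved_sum [::] M| <= e^-1 * vpow e M
    & (fun x : nat => L * \prod_(p <- primes_upto x) (1 - chi p * wpow e p))
        @ \oo --> (1 : R)].
Proof.
pose b M := e^-1 * vpow e M.
have ei : 0 < e^-1 by rewrite invr_gt0.
have b_cvg0 : b @ \oo --> 0.
  by rewrite -(mulr0 e^-1); apply: cvgMl_tmp; apply: vpow_cvg0.
have tail M y : (0 < M <= y)%N -> `|sieved_sum [::] y - sieved_sum [::] M| <= b M.
  case/andP=> M_gt0 le_My; apply: le_trans (sum_wpow_tail_le y e_gt0 M_gt0).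
  rewrite /sieved_sum [X in `|X - _|](@big_cat_nat _ _ _ M.+1) //= addrAC subrr add0r.
  by apply: le_trans (ler_norm_sum _ _ _) _; apply: ler_sum => m _; apply: norm_f_le.
have [L LS] : exists L, forall M, `|L - sieved_sum [::] M.+1| <= b M.+1.
  by apply: bounded_tail_limit => M y le_My; apply: tail.
have {}LS M : (0 < M)%N -> `|L - sieved_sum [::] M| <= b M by case: M.
have cvgL : sieved_sum [::] @ \oo --> L.
  apply/cvgrPdist_le => eps eps_gt0.
  have /cvgrPdist_le/(_ eps eps_gt0)[M0 _ HM0] := b_cvg0.
  exists M0.+1 => //= M lt_M; apply: le_trans (LS M _) _; first exact: leq_trans lt_M.
  by have := HM0 M (ltnW lt_M); rewrite sub0r normrN; apply: le_trans; rewrite ler_norm.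
pose E x := L * \prod_(p <- primes_upto x) (1 - chi p * wpow e p).
have E1 x : (0 < x)%N -> `|E x - 1| <= b x.
  move=> x_gt0; have prP : all prime (primes_upto x) by apply: filter_all.
  have uniqP : uniq (primes_upto x) by rewrite filter_uniq // iota_uniq.
  have cvgE := sieved_sum_cvg uniqP prP cvgL.
  have cvg_norm : `|sieved_sum (primes_upto x) y - 1| @[y --> \oo] --> `|E x - 1|.
    by apply: cvg_norm; apply: cvgB => //; apply: cvg_cst.
  apply: (cvgr_to_le cvg_norm).
  by exists x => // y le_xy; rewrite sieved_sum_primes_upto // x_gt0.
exists L; split=> //; last first.
  apply/cvgrPdist_le => eps eps_gt0.
  have /cvgrPdist_le/(_ eps eps_gt0)[M0 _ HM0] := b_cvg0.
  exists M0.+1 => //= M lt_M; rewrite distrC.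
  apply: le_trans (E1 M _) _; first exact: leq_trans lt_M.
  by have := HM0 M (ltnW lt_M); rewrite sub0r normrN; apply: le_trans; rewrite ler_norm.
(* Positivity of [L]: some [E x] is at least 1/2, and the Euler factors are positive. *)
have half_gt0 : 0 < (2^-1 : R) by rewrite invr_gt0.
have /cvgrPdist_le/(_ _ half_gt0)[M0 _ HM0] := b_cvg0.
have := HM0 M0.+1 (leqnSn _); rewrite sub0r normrN => /(le_trans (ler_norm _)).
move/(le_trans (E1 M0.+1 isT)); rewrite ler_norml => /andP[E_ge _].
have E_gt0 : 0 < E M0.+1 by lra.
rewrite -(pmulr_lgt0 _ (_ : 0 < \prod_(p <- primes_upto M0.+1) (1 - chi p * wpow e p))) //.
rewrite big_seq; apply: prodr_gt0 => p; rewrite mem_filter => /andP[p_pr _].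
rewrite subr_gt0; apply: le_lt_trans (ler_norm _) _; apply: le_lt_trans (norm_f_le p) _.
apply: le_lt_trans (wpow_le p (ltW e_gt0)) _.
by rewrite invf_lt1 ?ltr0n ?ltr1n ?prime_gt1 ?prime_gt0.
Qed.

End EulerProduct.

Lemma fin_pos_lower_bound (R : realType) (I : finType) (e : I -> R) :
  (forall i, 0 < e i) -> exists2 e0, 0 < e0 & forall i, e0 <= e i.
Proof.
move=> e_gt0; pose s := \sum_i (e i)^-1.
have s_ge0 : 0 <= s by apply: sumr_ge0 => i _; rewrite invr_ge0 ltW.
exists (1 + s)^-1 => [|i]; first by rewrite invr_gt0; lra.
rewrite -[leRHS]invrK lef_pV2 ?posrE ?invr_gt0 //; last by lra.
rewrite /s (bigD1 i) //= addrCA lerDl addr_ge0 // sumr_ge0 // => j _.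
by rewrite invr_ge0 ltW.
Qed.

Lemma harmonic_pow2_ge (R : realType) (k : nat) :
  k%:R / 2 <= \sum_(1 <= j < 2 ^ k) (j%:R^-1 : R).
Proof.
elim: k => [|k IHk]; first by rewrite mul0r expn0 big_geq.
have k2_gt0 : (0 < 2 ^ k)%N by rewrite expn_gt0.
rewrite [leRHS](@big_cat_nat _ _ _ (2 ^ k)) //=; last by rewrite leq_exp2l.
rewrite -natr1 mulrDl lerD //.
apply: (@le_trans _ _ (\sum_(2 ^ k <= j < 2 ^ k.+1) (2 ^ k.+1)%:R^-1)).
  rewrite sumr_const_nat expnS mul2n -addnn addnK -[leRHS]mulr_natr addnn -mul2n natrM.
  by rewrite invfM -mulrA mulVf ?pnatr_eq0 -?lt0n // mulr1 mul1r.
apply: ler_sum_nat => j /andP[le_kj lt_j].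
by rewrite lef_pV2 ?posrE ?ltr0n ?ler_nat ?(ltnW lt_j) ?expn_gt0 ?(leq_trans k2_gt0 le_kj).
Qed.

(** * Behaviour of L-series as [e] decreases to 0 *)

Section SeriesBounds.
Variables (R : realType) (N : nat).
Hypothesis N_gt0 : (0 < N)%N.

Definition lseries_partial (chi : nat -> R) (e : R) (M : nat) : R :=
  \sum_(1 <= n < M.+1) chi n * wpow e n.

(** For [e > 0] this determines [L] as the value of the L-series at [1 + e], since [vpow e M] tends
    to 0. *)
Definition lseries_approx (chi : nat -> R) (e L : R) : Prop :=
  forall M, (0 < M)%N -> `|L - lseries_partial chi e M| <= e^-1 * vpow e M.

Lemma lseries_approx_le (chi : nat -> R) (e L a b : R) (M : nat) : 0 < e ->
    lseries_approx chi e L ->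
    (forall y, (M <= y)%N -> `|lseries_partial chi e y - a| <= b) ->
  `|L - a| <= b.
Proof.
move=> e_gt0 LS near_a; apply/ler_addgt0Pr => eps eps_gt0.
have cvg0 : e^-1 * vpow e n @[n --> \oo] --> (0 : R).
  by rewrite -(mulr0 e^-1); apply: cvgMl_tmp; apply: vpow_cvg0.
have /cvgrPdist_le/(_ eps eps_gt0)[M0 _ HM0] := cvg0.
pose y := (maxn M M0).+1.
have le_My : (M <= y)%N by rewrite leqW // leq_maxl.
have := HM0 y; rewrite /= sub0r normrN => /(_ (leqW (leq_maxr _ _))) le_eps.
rewrite -(subrKA (lseries_partial chi e y)) addrC.
apply: le_trans (ler_normD _ _) _; rewrite lerD ?near_a //.
exact: le_trans (LS y isT) (le_trans (ler_norm _) le_eps).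
Qed.

Lemma lseries_partial_dist0 (chi : nat -> R) (e : R) (M : nat) :
    real_character N chi -> 0 <= e ->
  `|lseries_partial chi 0 M - lseries_partial chi e M| <= M%:R * e.
Proof.
move=> chiP e_ge0; rewrite /lseries_partial -sumrB.
apply: le_trans (ler_norm_sum _ _ _) _.
apply: (@le_trans _ _ (\sum_(1 <= n < M.+1) e)); last first.
  by rewrite sumr_const_nat subSS subn0 -[leLHS]mulr_natl.
apply: ler_sum_nat => n /andP[n_gt0 _]; rewrite -mulrBr normrM.
apply: le_trans (ler_piMl (normr_ge0 _) (rchar_norm_le chiP n)) _.
have -> : wpow 0 n = n%:R^-1 :> R by rewrite /wpow /vpow mul0r oppr0 expR0 mulr1.
have := wpow_le n e_ge0; have := wpow_ge e_ge0 n_gt0.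
by rewrite ler_norml; lra.
Qed.

Section NonPrincipal.
Variable chi : nat -> R.
Hypotheses (chiP : real_character N chi) (chi_np : exists a, chi a = -1).

(** Abel summation against decreasing weights; the bound is uniform in [e]. *)
Lemma lseries_partial_tail (e : R) (M y : nat) : 0 <= e -> (M <= y)%N ->
  `|lseries_partial chi e y - lseries_partial chi e M| <= 2 * N%:R / M.+1%:R.
Proof.
move=> e_ge0 le_My; rewrite /lseries_partial.
rewrite [X in `|X - _|](@big_cat_nat _ _ _ M.+1) //= addrAC subrr add0r.
apply: (@le_trans _ _ (2 * N%:R * wpow e M.+1)); last first.
  by rewrite ler_wpM2l ?mulr_ge0 // wpow_le.
apply: abel_bound_monotone => // [x le_Mx|n _|n lt_Mn].
- exact: rchar_sum_nat_le.
- exact: wpow_ge0.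
- by rewrite wpow_noninc // (leq_trans _ lt_Mn).
Qed.

Lemma lseries_nonprincipal_bounds :
  exists c e0, [/\ 0 < c, 0 < e0 &
    forall e L, 0 < e <= e0 -> lseries_approx chi e L -> 0 < L -> c <= L <= 2 * N%:R].
Proof.
have [ell ellP] : exists ell, forall M,
    `|ell - lseries_partial chi 0 M| <= 2 * N%:R / M.+1%:R.
  by apply: bounded_tail_limit => M y; apply: lseries_partial_tail.
have ell_neq0 : ell != 0.
  apply: (rchar_L1_neq0 N_gt0 chiP chi_np) => x.
  have <- : lseries_partial chi 0 x = \sum_(1 <= n < x.+1) chi n / n%:R.
    by apply: eq_bigr => n _; rewrite /wpow /vpow mul0r oppr0 expR0 mulr1.
  exact: ellP.
have ell_gt0 : 0 < `|ell| by rewrite normr_gt0.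
(* Beyond [M] the tails are at most [|ell| / 8] for every [e >= 0], and for [e <= e0] the [M]-th
   partial sum moves by at most [|ell| / 4]. This leaves [L >= |ell| / 2]. *)
pose M := Num.bound (16 * N%:R / `|ell|).
have M_gt : 16 * N%:R / `|ell| < M%:R.
  by apply: archi_boundP; rewrite divr_ge0 // mulr_ge0.
have tail_small : 2 * N%:R / M.+1%:R <= `|ell| / 8.
  rewrite ler_pdivrMr ?ltr0n // -[M.+1%:R]natr1.
  by move: M_gt; rewrite ltr_pdivrMr //; lra.
exists (`|ell| / 2), (`|ell| / (4 * M.+1%:R)); split; rewrite ?divr_gt0 ?mulr_gt0 ?ltr0n //.
move=> e L /andP[e_gt0 e_le] LS L_gt0.
have LM K : `|L - lseries_partial chi e K| <= 2 * N%:R / K.+1%:R.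
  apply: (lseries_approx_le e_gt0 LS) => y; apply: lseries_partial_tail; exact: ltW.
apply/andP; split; last first.
  have := LM 0%N; rewrite /lseries_partial big_geq // subr0 divr1.
  exact: le_trans (ler_norm _).
have h1 := ellP M; have h2 := LM M; have h3 := lseries_partial_dist0 M chiP (ltW e_gt0).
have h4 : M%:R * e <= `|ell| / 4.
  move: e_le; rewrite ler_pdivlMr ?mulr_gt0 ?ltr0n // -[M.+1%:R]natr1.
  have : 0 <= M%:R :> R by [].
  by move: (M%:R : R) => m m0; lra.
have : `|ell| <= L + (2 * N%:R / M.+1%:R + M%:R * e + 2 * N%:R / M.+1%:R).
  rewrite -[X in _ <= X + _](gtr0_norm L_gt0) -lerBlDl.
  apply: le_trans (lerB_dist _ _) _.
  apply: (@le_trans _ _ (`|ell - lseries_partial chi 0 M|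
    + `|lseries_partial chi 0 M - lseries_partial chi e M|
    + `|L - lseries_partial chi e M|)); last by rewrite !lerD.
  rewrite [X in _ <= _ + X]distrC.
  apply: le_trans (lerD (ler_normD _ _) (lexx _)).
  apply: le_trans (ler_normD _ _).
  by rewrite le_eqVlt; apply/orP; left; apply/eqP; congr (`|_|); ring.
move: tail_small h4; move: (2 * N%:R / M.+1%:R) (M%:R * e) => b c; lra.
Qed.

End NonPrincipal.

(** At [e = 0] the terms [n = 1 + j N <= 2 j N] with [j >= 1] already diverge. Take [M] with partial
    sum at least [C + 1]; for [e <= 1 / M] it drops by at most 1, and later terms are
    nonnegative. *)
Lemma lseries_principal_unbounded (C : R) :
  exists2 e0, 0 < e0 &
    forall e L, 0 < e <= e0 ->
      lseries_approx (fun n => (coprime n N)%:R) e L -> C <= L.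
Proof.
pose chi n : R := (coprime n N)%:R; have chiP : real_character N chi := rchar_principal R N.
have chi_ge0 n : 0 <= chi n by [].
have [k le_k] : exists k : nat, C + 1 <= (k%:R / 2) / (2 * N%:R).
  have [k le_k] : exists k : nat, (C + 1) * (4 * N%:R) <= k%:R.
    exists (Num.bound `|(C + 1) * (4 * N%:R)|); apply: le_trans (ler_norm _) _.
    by rewrite ltW // archi_boundP.
  exists k; rewrite ler_pdivlMr ?mulr_gt0 ?ltr0n //; lra.
pose M := (2 ^ k * N)%N.
have M_gt0 : (0 < M)%N by rewrite muln_gt0 expn_gt0.
have S0_ge : C + 1 <= lseries_partial chi 0 M.
  apply: (le_trans le_k).
  apply: le_trans (ler_wpM2r _ (harmonic_pow2_ge R k)) _; first by rewrite invr_ge0 mulr_ge0.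
  pose F n := chi n * wpow 0 n.
  have F_ge0 n : 0 <= F n by rewrite mulr_ge0 // wpow_ge0.
  have sub_le K : \sum_(0 <= j < K) F (1 + j * N)%N <= \sum_(1 <= n < (K * N).+1) F n.
    elim: K => [|K IHK]; first by rewrite !big_geq.
    have lt_KN : (K * N < K.+1 * N)%N by rewrite mulSn -[ltnLHS]add0n ltn_add2r.
    rewrite big_nat_recr //= [leRHS](@big_cat_nat _ _ _ (K * N).+1) //=; last exact: ltnW.
    rewrite lerD // big_ltn ?ltnS // add1n lerDl sumr_ge0 //.
  apply: le_trans (sub_le (2 ^ k)%N).
  rewrite [leRHS]big_ltn ?expn_gt0 // mulr_suml -[leLHS]add0r lerD //.
  apply: ler_sum_nat => j /andP[j_gt0 _].
  have -> : F (1 + j * N)%N = (1 + j * N)%N%:R^-1.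
    rewrite /F /chi /wpow /vpow mul0r oppr0 expR0 mulr1.
    by rewrite /coprime -gcdn_modl addnC modnMDl gcdn_modl -/(coprime 1 N) coprime1n mul1r addnC.
  rewrite -invfM lef_pV2 ?posrE ?mulr_gt0 ?ltr0n //.
  by rewrite -!natrM ler_nat; nia.
exists (M%:R^-1); first by rewrite invr_gt0 ltr0n.
move=> e L /andP[e_gt0 e_le] LS.
have SM : C <= lseries_partial chi e M.
  have := lseries_partial_dist0 M chiP (ltW e_gt0).
  have : M%:R * e <= 1 by rewrite -ler_pdivlMl ?ltr0n // mulr1.
  rewrite ler_norml; lra.
apply: (le_trans SM); rewrite -subr_ge0.
apply/ler_addgt0Pr => eps eps_gt0.
have cvg0 : e^-1 * vpow e n @[n --> \oo] --> (0 : R).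
  by rewrite -(mulr0 e^-1); apply: cvgMl_tmp; apply: vpow_cvg0.
have /cvgrPdist_le/(_ eps eps_gt0)[M0 _ HM0] := cvg0.
pose y := (maxn M M0).+1.
have := HM0 y; rewrite /= sub0r normrN => /(_ (leqW (leq_maxr _ _))) le_eps.
have le_S : lseries_partial chi e M <= lseries_partial chi e y.
  rewrite /lseries_partial [leRHS](@big_cat_nat _ _ _ M.+1) //=; last first.
    by rewrite ltnS leqW // leq_maxl.
  by rewrite lerDl sumr_ge0 // => n _; rewrite mulr_ge0 // wpow_ge0.
have := le_trans (LS y isT) (le_trans (ler_norm _) le_eps).
by rewrite ler_norml; lra.
Qed.

End SeriesBounds.

Lemma cvg_prodr (R : realType) (J : finType) (P : pred J) (F : J -> nat -> R) (l : J -> R) :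
    (forall j, P j -> F j x @[x --> \oo] --> l j) ->
  \prod_(j | P j) F j x @[x --> \oo] --> \prod_(j | P j) l j.
Proof. by move=> cvgF; apply: cvg_big => //; exact: mul_continuous. Qed.

(** * Products of L-series over even and odd sets of characters *)

Section IndependentCharacters.
Variables (R : realType) (N : nat) (I : finType) (chi : I -> nat -> R).
Hypotheses (N_gt0 : (0 < N)%N) (chiP : forall i, real_character N (chi i)).
Hypothesis chi_indep : forall S : {set I}, S != finset.set0 ->
  exists2 a, coprime a N & \prod_(i in S) chi i a = -1.

(** The coprimality factor turns the empty product into the principal character. *)
Definition subset_rchar (S : {set I}) (n : nat) : R :=
  (coprime n N)%:R * \prod_(i in S) chi i n.

Lemma real_character_subset S : real_character N (subset_rchar S).
Proof.
have -> : subset_rchar S = (fun n => (coprime n N)%:R * \prod_(i <- enum S) chi i n).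
  by apply/funext => n; rewrite /subset_rchar -big_enum.
elim: (enum S) => [|i s IHs].
  rewrite (_ : (fun n => _) = (fun n => (coprime n N)%:R)); last first.
    by apply/funext => n; rewrite big_nil mulr1.
  exact: rchar_principal.
rewrite (_ : (fun n => _) =
    (fun n => chi i n * ((coprime n N)%:R * \prod_(j <- s) chi j n))).
  exact: rchar_mulr.
by apply/funext => n; rewrite big_cons mulrCA.
Qed.

Lemma subset_rchar0 : subset_rchar finset.set0 = (fun n => (coprime n N)%:R).
Proof. by apply/funext => n; rewrite /subset_rchar big_set0 mulr1. Qed.

Lemma subset_rchar_nonprincipal S : S != finset.set0 -> exists a, subset_rchar S a = -1.
Proof.
by case/chi_indep => a co_a prod_a; exists a; rewrite /subset_rchar co_a mul1r.
Qed.

Definition anti_prime (p : nat) : bool :=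
  [&& prime p, coprime p N & [forall i, chi i p == -1]].

(* If some [chi i p = 1], then toggling [i] in [S] matches the factors with [#|S|]
   even to those with [#|S|] odd. *)
Lemma even_odd_local (p : nat) (t : R) : prime p -> 0 <= t <= p%:R^-1 ->
  (if anti_prime p then (1 - p%:R^-1) ^+ #|{: {set I}}| else 1)
    * \prod_(S : {set I} | odd #|S|) (1 - subset_rchar S p * t)
  <= \prod_(S : {set I} | ~~ odd #|S|) (1 - subset_rchar S p * t).
Proof.
move=> p_pr /andP[t_ge0 t_le].
have p_gt1 : 1 < p%:R :> R by rewrite ltr1n prime_gt1.
have pV_lt1 : p%:R^-1 < 1 :> R by rewrite invf_lt1 // (lt_trans ltr01).
have pV_ge0 : 0 <= p%:R^-1 :> R by rewrite invr_ge0.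
rewrite /anti_prime p_pr /=; have [co_p|nco_p] := boolP (coprime p N); last first.
  by rewrite mul1r !big1 // => S _; rewrite /subset_rchar (negPf nco_p) mul0r mul0r subr0.
have [anti|/forallPn[i]] := boolP [forall i, chi i p == -1]; last first.
  case: (rchar_unit (chiP i) co_p) => [chi1 _|->]; last by rewrite eqxx.
  rewrite mul1r; pose h (S : {set I}) := if i \in S then S :\ i else i |: S.
  have hK : involutive h.
    move=> S; rewrite /h; case: (boolP (i \in S)) => iS.
      by rewrite setD11 finset.setD1K.
    by rewrite setU11 setU1K.
  rewrite (reindex_inj (inv_inj hK)) /= le_eqVlt; apply/orP; left; apply/eqP.
  apply: eq_big => S.
    rewrite /h; case: (boolP (i \in S)) => iS.
      by rewrite [in RHS](cardsD1 i) iS /= negbK.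
    by rewrite cardsU1 iS.
  move=> _; congr (1 - _ * t); rewrite /subset_rchar /h; congr (_ * _).
  case: (boolP (i \in S)) => iS.
    by rewrite [RHS](big_setD1 i) //= chi1 mul1r.
  by rewrite big_setU1 //= chi1 mul1r.
have val S : subset_rchar S p = (-1) ^+ #|S|.
  rewrite /subset_rchar co_p mul1r -prodr_const; apply: eq_bigr => i _.
  exact/eqP/(forallP anti).
(* At an anti-prime the factors are [1 + t] for odd [#|S|] and [1 - t] for even. One copy of
   [1 - 1/p] goes to each [S]: [(1 - 1/p) (1 + t) <= 1] and [1 - 1/p <= 1 - t]. *)
rewrite -prodr_const (bigID (fun S : {set I} => odd #|S|)) /= [leLHS]mulrAC.
rewrite -big_split /=.
rewrite -[leRHS]mul1r ler_pM //.
- apply: prodr_ge0 => S oddS; rewrite val -signr_odd oddS expr1.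
  by rewrite mulN1r opprK; nra.
- by apply: prodr_ge0 => S _; rewrite subr_ge0 ltW.
- apply: prodr_ile1 => S oddS; rewrite val -signr_odd oddS expr1 mulN1r opprK.
  by apply/andP; split; nra.
- apply: ler_prod => S evenS; rewrite val -signr_odd (negPf evenS) expr0 mul1r.
  by rewrite subr_ge0 ltW //= lerB.
Qed.

(** If the products stayed at least [c], multiplying [even_odd_local] over the primes would give, in
    the limit, [c^K] times the product of the even [L S] at most that of the odd ones. For small [e]
    the principal [L S] is arbitrarily large, and the others lie between positive constants. *)
Theorem prod_anti_prime_small (c : R) : 0 < c ->
  exists x, \prod_(p <- primes_upto x | anti_prime p) (1 - p%:R^-1) < c.
Proof.
move=> c_gt0; apply: contrapT => /forallNP not_lt.
have ge_c x : c <= \prod_(p <- primes_upto x | anti_prime p) (1 - p%:R^-1).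
  by rewrite leNgt; apply/negP; apply: not_lt.
pose K := #|{: {set I}}|.
have boundsS (S : {set I}) : exists ce : R * R, [/\ 0 < ce.1, 0 < ce.2 &
    S != finset.set0 -> forall e L, 0 < e <= ce.2 -> lseries_approx (subset_rchar S) e L ->
      0 < L -> ce.1 <= L <= 2 * N%:R].
  (* The constants for the empty set are dummies. *)
  have [->|S0] := eqVneq S finset.set0; first by exists (1, 1); split.
  have [a [e0 [a0 e00 H]]] := lseries_nonprincipal_bounds N_gt0
    (real_character_subset S) (subset_rchar_nonprincipal S0).
  by exists (a, e0); split.
have {boundsS}[ce ceP] := choice boundsS.
pose B := \prod_(S : {set I} | ~~ odd #|S| && (S != finset.set0)) (ce S).1.
pose A := \prod_(S : {set I} | odd #|S|) (2 * N%:R : R).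
have B_gt0 : 0 < B by apply: prodr_gt0 => S _; case: (ceP S).
have cK_gt0 : 0 < c ^+ K by rewrite exprn_gt0.
(* This threshold raises the even side to [A + c^K B], above the bound [A] of the odd side. *)
have [e1 e1_gt0 unbdd] := lseries_principal_unbounded N_gt0 (A / (c ^+ K * B) + 1).
have [e2 e2_gt0 e2_le] : exists2 e2, 0 < e2 & forall S, e2 <= (ce S).2.
  by apply: fin_pos_lower_bound => S; case: (ceP S).
pose e := Order.min e1 e2.
have e_gt0 : 0 < e by rewrite lt_min e1_gt0.
have limS (S : {set I}) : exists L, [/\ 0 < L, lseries_approx (subset_rchar S) e L &
    (fun x : nat => L * \prod_(p <- primes_upto x) (1 - subset_rchar S p * wpow e p))
        @ \oo --> (1 : R)].
  have [L [L0 LS cvgL]] := lseries_limit (real_character_subset S) e_gt0.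
  by exists L; split=> // M M_gt0; have := LS M M_gt0.
have {limS}[L LP] := choice limS.
pose E S x := L S * \prod_(p <- primes_upto x) (1 - subset_rchar S p * wpow e p).
have cvgE (P : pred {set I}) : \prod_(S | P S) E S x @[x --> \oo] --> (1 : R).
  rewrite [X in _ --> X](_ : 1 = \prod_(S : {set I} | P S) (1 : R)); last by rewrite big1.
  by apply: cvg_prodr => S _; case: (LP S).
have prodE (Q : pred {set I}) x : \prod_(S | Q S) E S x = (\prod_(S | Q S) L S)
    * \prod_(p <- primes_upto x) \prod_(S | Q S) (1 - subset_rchar S p * wpow e p).
  by rewrite exchange_big /= -big_split.
have L_ge0 (P : pred {set I}) : 0 <= \prod_(S | P S) L S.
  by apply: prodr_ge0 => S _; case: (LP S) => /ltW.
have ineq x : c ^+ K * \prod_(p <- primes_upto x)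
      \prod_(S : {set I} | odd #|S|) (1 - subset_rchar S p * wpow e p)
    <= \prod_(p <- primes_upto x)
      \prod_(S : {set I} | ~~ odd #|S|) (1 - subset_rchar S p * wpow e p).
  have wpow_p p : p \in primes_upto x -> prime p /\ 0 <= wpow e p <= p%:R^-1.
    by rewrite mem_filter => /andP[p_pr _]; rewrite wpow_ge0 wpow_le // ltW.
  have odd_ge0 p : p \in primes_upto x ->
      0 <= \prod_(S : {set I} | odd #|S|) (1 - subset_rchar S p * wpow e p).
    case/wpow_p => p_pr /andP[w0 w1]; apply: prodr_ge0 => S _.
    rewrite subr_ge0 (le_trans (ler_norm _)) // normrM (ger0_norm w0).
    rewrite mulr_ile1 ?(rchar_norm_le (real_character_subset S)) //.
    by rewrite (le_trans w1) // invf_le1 ?ltr0n ?prime_gt0 // ler1n prime_gt0.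
  apply: (@le_trans _ _ (\prod_(p <- primes_upto x)
      ((if anti_prime p then (1 - p%:R^-1) ^+ K else 1)
       * \prod_(S : {set I} | odd #|S|) (1 - subset_rchar S p * wpow e p)))); last first.
    rewrite big_seq [leRHS]big_seq; apply: ler_prod => p px.
    have [p_pr w_p] := wpow_p p px.
    rewrite even_odd_local // andbT mulr_ge0 ?odd_ge0 //; case: ifP => // _.
    by rewrite exprn_ge0 // subr_ge0 invf_le1 ?ltr0n ?prime_gt0 // ler1n prime_gt0.
  rewrite big_split /= ler_wpM2r //; first by rewrite big_seq prodr_ge0.
  rewrite -big_mkcond /= prodrXl; have c_ge0 := ltW c_gt0.
  by rewrite lerXn2r ?nnegrE ?(le_trans c_ge0 (ge_c x)).
have LL : c ^+ K * \prod_(S : {set I} | ~~ odd #|S|) L S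
    <= \prod_(S : {set I} | odd #|S|) L S.
  pose F x := c ^+ K * \prod_(S : {set I} | ~~ odd #|S|) L S
    * \prod_(S : {set I} | odd #|S|) E S x.
  pose G x := \prod_(S : {set I} | odd #|S|) L S
    * \prod_(S : {set I} | ~~ odd #|S|) E S x.
  have cvgF : F @ \oo --> c ^+ K * \prod_(S : {set I} | ~~ odd #|S|) L S.
    by rewrite -[X in _ --> X]mulr1; apply: cvgMl_tmp; apply: cvgE.
  have cvgG : G @ \oo --> \prod_(S : {set I} | odd #|S|) L S.
    by rewrite -[X in _ --> X]mulr1; apply: cvgMl_tmp; apply: cvgE.
  apply: (ler_cvg_to cvgF cvgG); apply: nearW => x; rewrite /F /G !prodE.
  have Le_ge0 := L_ge0 (fun S => ~~ odd #|S|); have Lo_ge0 := L_ge0 (fun S => odd #|S|).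
  by rewrite [leLHS]mulrCA ler_wpM2l // -[leLHS]mulrA [leLHS]mulrCA ler_wpM2l //.
have A_ge0 : 0 <= A by apply: prodr_ge0 => S _; rewrite mulr_ge0.
have cKB_gt0 : 0 < c ^+ K * B by rewrite mulr_gt0.
have L_even : (A / (c ^+ K * B) + 1) * B <= \prod_(S : {set I} | ~~ odd #|S|) L S.
  rewrite (bigD1 finset.set0) ?cards0 //=; apply: ler_pM.
  - by rewrite addr_ge0 // divr_ge0 // ltW.
  - exact: ltW.
  - case: (LP finset.set0) => _; rewrite subset_rchar0 => approx0 _.
    by apply: unbdd approx0; rewrite e_gt0 ge_min lexx.
  - apply: ler_prod => S /andP[_ S0]; have [c1 _ H] := ceP S; have [L0 app _] := LP S.
  have e_le : 0 < e <= (ce S).2 by rewrite e_gt0 ge_min e2_le orbT.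
  by have /andP[lo hi] := H S0 e (L S) e_le app L0; rewrite ?lo ?hi ?ltW.
have L_odd : \prod_(S : {set I} | odd #|S|) L S <= A.
  apply: ler_prod => S oddS; have [c1 _ H] := ceP S; have [L0 app _] := LP S.
  have S0 : S != finset.set0 by apply: contraTneq oddS => ->; rewrite cards0.
  have e_le : 0 < e <= (ce S).2 by rewrite e_gt0 ge_min e2_le orbT.
  by have /andP[lo hi] := H S0 e (L S) e_le app L0; rewrite ?lo ?hi ?ltW.
have := le_trans (ler_wpM2l (ltW cK_gt0) L_even) (le_trans LL L_odd).
have cancelB (a b k : R) : 0 < b -> 0 < k -> k * ((a / (k * b) + 1) * b) = a + k * b.
  by move=> b_gt0 k_gt0; field; rewrite !gt_eqF.
by rewrite cancelB // gerDl leNgt cKB_gt0.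
Qed.

End IndependentCharacters.

(** * Legendre symbols *)

Section Legendre.
Variables (R : realType) (q : nat).
Hypotheses (q_pr : prime q) (q_odd : odd q).

Definition euler_power (n : nat) : 'F_q := n%:R ^+ q.-1./2.

(** The Legendre symbol, defined through Euler's criterion. *)
Definition legendre (n : nat) : R :=
  if euler_power n == 0 then 0 else if euler_power n == 1 then 1 else -1.

Let neq11 : (-1 : 'F_q) != 1.
Proof.
rewrite eq_sym -addr_eq0 -[1 + 1]/(2%:R) -(dvdn_pcharf (pchar_Fp q_pr)).
by rewrite dvdn_prime2 //; apply: contraTneq q_odd => ->.
Qed.

Lemma euler_power_eq0 n : (euler_power n == 0) = (q %| n)%N.
Proof.
have q_gt2 := odd_prime_gt2 q_odd q_pr.
rewrite /euler_power expf_eq0 -(dvdn_pcharf (pchar_Fp q_pr)) half_gt0.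
by rewrite -ltnS prednK ?prime_gt0 // q_gt2.
Qed.

Lemma euler_power_sign n : ~~ (q %| n)%N -> euler_power n = 1 \/ euler_power n = -1.
Proof.
move=> not_qn; have n0 : (n%:R : 'F_q) != 0 by rewrite -(dvdn_pcharf (pchar_Fp q_pr)).
suff : (euler_power n == 1) || (euler_power n == -1).
  by case/orP=> /eqP ->; [left | right].
rewrite -eqf_sqr expr1n /euler_power -exprM muln2.
have -> : (q.-1./2.*2 = q.-1)%N.
  by rewrite halfK; case: q q_pr q_odd => // k _ /= /negPf ->; rewrite subn0.
apply/eqP/(mulfI n0); rewrite mulr1 -exprS prednK ?prime_gt0 //.
by rewrite -[RHS]expf_card card_Fp.
Qed.

Lemma legendreM m n : legendre (m * n) = legendre m * legendre n.
Proof.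
have epM : euler_power (m * n) = euler_power m * euler_power n.
  by rewrite /euler_power natrM exprMn.
rewrite /legendre !euler_power_eq0 Euclid_dvdM // epM.
have [|qm] := boolP (q %| m)%N; first by rewrite mul0r.
have [|qn] := boolP (q %| n)%N; first by rewrite mulr0.
by case: (euler_power_sign qm) => ->; case: (euler_power_sign qn) => -> /=;
  rewrite ?mulrNN ?mulrN ?mulNr ?mulr1 ?eqxx ?(negPf neq11) // ?mulrNN ?mulr1 ?mul1r.
Qed.

Lemma eq_legendre m n : m = n %[mod q] -> legendre m = legendre n.
Proof.
move=> eq_mn; rewrite /legendre (_ : euler_power m = euler_power n) //.
rewrite /euler_power; congr (_ ^+ _); apply: val_inj => /=.
by rewrite !val_Fp_nat.
Qed.

Lemma legendre1 : legendre 1 = 1.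
Proof. by rewrite /legendre /euler_power expr1n oner_eq0 eqxx. Qed.

Lemma legendre_unit n : ~~ (q %| n)%N -> legendre n = 1 \/ legendre n = -1.
Proof.
move=> not_qn; rewrite /legendre euler_power_eq0 (negPf not_qn).
by case: ifP => _; [left | right].
Qed.

(** The polynomial [X^((q - 1)/2) - 1] has too few roots to vanish at all [q - 1] nonzero
    elements. *)
Lemma legendre_nonresidue : exists2 b, ~~ (q %| b)%N & legendre b = -1.
Proof.
have q_gt2 := odd_prime_gt2 q_odd q_pr.
have [x x0 x1] : exists2 x : 'F_q, x != 0 & x ^+ q.-1./2 != 1.
  apply/exists_inP; apply: contraT; rewrite negb_exists => /forallP all1.
  pose p : {poly 'F_q} := 'X^(q.-1./2) - 1.
  have half_gt0 : (0 < q.-1./2)%N by rewrite half_gt0 -ltnS prednK // prime_gt0.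
  have size_p : size p = q.-1./2.+1 by rewrite size_XnsubC.
  have p0 : p != 0 by rewrite -size_poly_eq0 size_p.
  pose s := enum [pred x : 'F_q | x != 0].
  have root_s : all (root p) s.
    apply/allP => x; rewrite mem_enum inE => x0.
    have := all1 x; rewrite x0 /= negbK => /eqP xq.
    by rewrite /root !hornerE xq subrr.
  have := max_poly_roots p0 root_s (enum_uniq _).
  have -> : size s = q.-1.
    by rewrite -cardE; have := cardC1 (0 : 'F_q); rewrite card_Fp.
  rewrite size_p ltnS leqNgt -{2}(odd_double_half q.-1) -addnn; lia.
exists x; first by rewrite (dvdn_pcharf (pchar_Fp q_pr)) natr_Zp.
have eqx : euler_power x = x ^+ q.-1./2 by rewrite /euler_power natr_Zp.
rewrite /legendre eqx (negPf x1); case: eqP => // /eqP.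
by rewrite expf_eq0 (negPf x0) andbF.
Qed.

End Legendre.

Lemma chinese_nonresidue (R : realType) (q M : nat) : prime q -> odd q -> coprime q M ->
  exists a, [/\ coprime a (q * M), legendre R q a = -1 & a = 1 %[mod M]].
Proof.
move=> q_pr q_odd co_qM; have [b not_qb leg_b] := legendre_nonresidue R q_pr q_odd.
have eq_b : chinese q M b 1 = b %[mod q] := chinese_modl co_qM b 1.
have eq_1 : chinese q M b 1 = 1 %[mod M] := chinese_modr co_qM b 1.
exists (chinese q M b 1); split=> //; last by rewrite (eq_legendre _ q_pr eq_b).
rewrite coprimeMr -coprime_modl eq_b coprime_modl -[coprime _ M]coprime_modl eq_1 coprime_modl.
by rewrite coprime1n andbT coprime_sym prime_coprime.
Qed.

Definition primorial (m : nat) : nat := \prod_(i < m.+1 | prime i) i.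

Section OddPrimesUpto.
Variables (R : realType) (m : nat).

Definition odd_prime_ord : Type := {q : 'I_m.+1 | prime q && odd q}.
HB.instance Definition _ := Finite.on odd_prime_ord.

Lemma primorial_gt0 : (0 < primorial m)%N.
Proof. by apply: prodn_cond_gt0 => i /prime_gt0. Qed.

Lemma dvdn_primorial p : prime p -> (p <= m)%N -> (p %| primorial m)%N.
Proof.
move=> p_pr; rewrite -ltnS => le_pm.
by rewrite /primorial (bigD1 (Ordinal le_pm)) //= dvdn_mulr.
Qed.

(** The Legendre symbol lifted to a modulus common to all the primes. *)
Definition legendre_char (i : odd_prime_ord) (n : nat) : R :=
  (coprime n (primorial m))%:R * legendre R (val (val i)) n.

Lemma legendre_char_real i : real_character (primorial m) (legendre_char i).
Proof.
have /andP[q_pr q_odd] := valP i; set q := nat_of_ord (val i) in q_pr q_odd.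
have q_dvd : (q %| primorial m)%N by rewrite dvdn_primorial // -ltnS ltn_ord.
split=> [a b|a|a co|a /negPf nco]; rewrite /legendre_char -/q.
- by rewrite legendreM // coprimeMl -mulnb natrM mulrACA.
- rewrite (_ : coprime _ _ = coprime a (primorial m)); last first.
    by rewrite /coprime -gcdn_modl modnDr gcdn_modl.
  congr (_ * _); apply: eq_legendre => //.
  by have /dvdnP[k ->] := q_dvd; rewrite addnC modnMDl.
- rewrite co mul1r; apply: legendre_unit => //.
  by rewrite -prime_coprime // coprime_sym (coprime_dvdr q_dvd).
- by rewrite nco mul0r.
Qed.

(** Fix [i] in [S] and take [a] a nonresidue modulo its prime and 1 modulo all other primes up to
    [m]; only the factor at [i] is -1. *)
Lemma legendre_char_indep (S : {set odd_prime_ord}) : S != finset.set0 ->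
  exists2 a, coprime a (primorial m) & \prod_(i in S) legendre_char i a = -1.
Proof.
case/finset.set0Pn=> i iS; have /andP[q_pr q_odd] := valP i.
set q := nat_of_ord (val i) in q_pr q_odd.
pose M := (\prod_(j < m.+1 | prime j && (j != val i)) j)%N.
have defN : primorial m = (q * M)%N by rewrite /primorial (bigD1 (val i)).
have co_qM : coprime q M.
  apply: (big_ind (coprime q)) => [|x y|j /andP[j_pr neq_j]]; first exact: coprimen1.
    by rewrite coprimeMr => -> ->.
  by rewrite prime_coprime // dvdn_prime2 // eq_sym.
have [a [co_a leg_a mod_a]] := chinese_nonresidue R q_pr q_odd co_qM.
exists a; first by rewrite defN.
rewrite (bigD1 i) //= /legendre_char defN co_a mul1r -/q leg_a big1 ?mulr1 // => j.
case/andP=> _ neq_ji; have /andP[r_pr r_odd] := valP j.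
set r := nat_of_ord (val j) in r_pr r_odd *.
have r_dvd : (r %| M)%N.
  by rewrite /M (bigD1 (val j)) //= ?dvdn_mulr // r_pr (inj_eq val_inj).
rewrite mul1r -(legendre1 R r); apply: eq_legendre => //.
by rewrite -(modn_dvdm a r_dvd) mod_a modn_dvdm.
Qed.

(** [T] consists of anti-primes: coprime to the primorial, they exceed [m], and a symbol equal to -1
    rules out [p = 1] modulo [q]. *)
Theorem primes_not_1_mod_small (eps : R) : (2 <= m)%N -> 0 < eps -> exists T : seq nat,
  [/\ uniq T, all prime T,
      forall p, p \in T -> (m < p)%N,
      forall p q, p \in T -> prime q -> odd q -> (q <= m)%N -> p <> 1 %[mod q]
    & \prod_(p <- T) (1 - p%:R^-1 + p%:R^-2) < eps].
Proof.
move=> m_ge2 eps_gt0.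
have [x small] := prod_anti_prime_small primorial_gt0 legendre_char_real
  legendre_char_indep (exprn_gt0 2 eps_gt0).
pose T := [seq p <- primes_upto x | anti_prime (primorial m) legendre_char p].
have T_anti p : p \in T -> [/\ prime p, coprime p (primorial m)
    & forall i, legendre_char i p = -1].
  by rewrite mem_filter => /andP[/and3P[p_pr co_p /forallP anti] _]; split=> // i; apply/eqP.
have T_gt p : p \in T -> (m < p)%N.
  case/T_anti => p_pr co_p _; rewrite ltnNge; apply: contraL co_p => le_pm.
  by rewrite prime_coprime // negbK dvdn_primorial.
exists T; split=> //.
- by rewrite !filter_uniq ?iota_uniq.
- by apply/allP => p /T_anti[].
- move=> p q /T_anti[p_pr co_p anti] q_pr q_odd le_qm eq1.
  have lt_qm : (q < m.+1)%N by [].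
  have iP : prime (Ordinal lt_qm) && odd (Ordinal lt_qm) by rewrite /= q_pr.
  have := anti (exist _ (Ordinal lt_qm) iP : odd_prime_ord).
  rewrite /legendre_char co_p mul1r /= (eq_legendre _ q_pr eq1) (legendre1 R q).
  by move/eqP; rewrite -subr_eq0 opprK -mulr2n pnatr_eq0.
rewrite -(@ltr_pXn2r _ 2) ?nnegrE ?(ltW eps_gt0) //; last first.
  rewrite big_seq; apply: prodr_ge0 => p /T_anti[p_pr _ _].
  by rewrite addr_ge0 ?subr_ge0 ?invr_ge0 ?exprn_ge0 // invf_le1 ?ltr0n ?prime_gt0 // ler1n prime_gt0.
apply: le_lt_trans small; rewrite -prodrXl -[leRHS]big_filter -/T.
rewrite big_seq [leRHS]big_seq; apply: ler_prod => p pT.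
rewrite exprn_even_ge0 //=; have p3 : 3 <= p%:R :> R.
  by rewrite ler_nat (leq_ltn_trans m_ge2) // T_gt.
have t_gt0 : 0 < p%:R^-1 :> R by rewrite invr_gt0; lra.
have t_le : p%:R^-1 <= 3^-1 :> R by rewrite lef_pV2 ?posrE //; lra.
rewrite -exprVn; move: (p%:R^-1 : R) t_gt0 t_le => t t0 t3.
(* For [t <= 1/3] the square of [1 - t + t^2] is at most [1 - t], which is why the product was made
   smaller than [eps^2]. *)
have -> : (1 - t + t ^+ 2) ^+ 2 = 1 - t - t * (1 - 3 * t + 2 * t ^+ 2 - t ^+ 3) by ring.
have t2_ge0 : 0 <= t ^+ 2 by exact: sqr_ge0.
have : t ^+ 3 <= t ^+ 2 by rewrite exprSr ler_piMr //; lra.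
by move=> t32; rewrite gerBl mulr_ge0 //; lra.
Qed.

End OddPrimesUpto.

(** * Finite quotients *)

Local Close Scope ring_scope.
Local Open Scope card_scope.
Local Open Scope group_scope.

(** * From abstract finite quotients to finite groups *)

Section Transport.
Variables (G : groupType) (m : nat) (f : G -> 'I_m) (g : 'I_m -> G).
Hypotheses (fK : cancel f g) (gK : cancel g f).

(** The inverse laws are arguments of the type, so that its group structure can use them. *)
Definition transport of cancel f g & cancel g f : Type := 'I_m.
Local Notation tT := (transport fK gK).

HB.instance Definition _ := Finite.on tT.

Let tmul (x y : tT) : tT := f (g x * g y).
Let tone : tT := f 1.
Let tinv (x : tT) : tT := f (g x)^-1.

Let tmulA : associative tmul.
Proof. by move=> x y z; rewrite /tmul !fK mulgA. Qed.
Let tmul1 : left_id tone tmul.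
Proof. by move=> x; rewrite /tmul /tone fK mul1g gK. Qed.
Let tmulV : left_inverse tone tinv tmul.
Proof. by move=> x; rewrite /tmul /tinv /tone fK mulVg. Qed.

HB.instance Definition _ := Finite_isGroup.Build tT tmulA tmul1 tmulV.

Definition to_transport : G -> tT := f.

Lemma to_transportM : {morph to_transport : x y / x * y}.
Proof. by move=> x y; rewrite {2}/mul /= /tmul !fK. Qed.

Lemma to_transport_surj (a : tT) : exists x, to_transport x = a.
Proof. by exists (g a); apply: gK. Qed.

Lemma card_transport : #|[set: tT]%SET| = m.
Proof. by rewrite cardsT card_ord. Qed.

End Transport.

Lemma finite_quotient_finGroup (G : groupType) (m : nat) :
    chi_F G m ->
  exists (gT : finGroupType) (phi : G -> gT),
    [/\ {morph phi : x y / x * y}, forall a, exists x, phi x = a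
      & #|[set: gT]%SET| = m].
Proof.
case=> N /card_set_bijP[h [fun_h inj_h surj_h]].
have lt_h a : (h a < m)%N by exact: fun_h.
pose f a : 'I_m := Ordinal (lt_h a).
have f_surj i : exists a, f a = i.
  have [a _ ha] := surj_h i (ltn_ord i).
  by exists a; apply: val_inj.
pose g i := sval (cid (f_surj i)).
have gK : cancel g f by move=> i; apply: (svalP (cid (f_surj i))).
have fK : cancel f g.
  move=> a; have /(congr1 val) /= := gK (f a).
  by apply: inj_h; rewrite inE.
exists (transport fK gK : finGroupType), (to_transport fK gK \o @to_quot G N).
split; last exact: card_transport.
  by move=> x y; rewrite /= to_quotM to_transportM.
move=> a; have [b <-] := to_transport_surj a.
by have [x <-] := to_quot_surj b; exists x.
Qed.

Section Kernel.
Variables (G : groupType) (gT : finGroupType) (phi : G -> gT).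
Hypothesis phiM : {morph phi : x y / x * y}.

Let phi1 : phi 1 = 1.
Proof. by apply: (mulgI (phi 1)); rewrite -phiM !mulg1. Qed.

Let phiV x : phi x^-1 = (phi x)^-1.
Proof. by apply: (mulgI (phi x)); rewrite -phiM !mulgV. Qed.

Let phiX x k : phi (x ^+ k) = phi x ^+ k.
Proof. by elim: k => [|k IHk]; rewrite ?expg0 // !expgS phiM IHk. Qed.

Definition kernel_subgroup : normal_subgroup G.
Proof.
exists [set x | phi x = 1] => /= [|x y px py|x px|x y px] //.
- by rewrite phiM px py mulg1.
- by rewrite phiV px invg1.
- by rewrite /conjg !phiM phiV px mul1g mulVg.
Defined.

Lemma kernel_quotP x y :
  to_quot kernel_subgroup x = to_quot kernel_subgroup y <-> phi x = phi y.
Proof.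
rewrite to_quotP /= phiM phiV; split=> [/(canRL (mulKVg _))|->].
  by rewrite mulg1.
by rewrite mulVg.
Qed.

(** [A] is the image of [phi], so the quotient by the kernel is cyclic and hence bounded; choosing
    preimages injects [A] into the ordinals below [n]. *)
Lemma cyclic_image_le (n : nat) (A : {group gT}) :
    (forall N : normal_subgroup G, cyclic_group (quot N) ->
       [set: quot N] #<= `I_n) ->
    (forall x, phi x \in A) -> (forall a, a \in A -> exists x, phi x = a) ->
    cyclic A ->
  (#|A| <= n)%N.
Proof.
move=> boundG phiA surjA /cyclicP[a defA].
have [g phig] : exists x, phi x = a by apply: surjA; rewrite defA cycle_id.
have cycQ : cyclic_group (quot kernel_subgroup).
  exists (to_quot kernel_subgroup g) => b; have [x <-] := to_quot_surj b.
  have /cycleP[k phix] : phi x \in <[a]> by rewrite -defA.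
  exists k; left; have -> : to_quot kernel_subgroup x = to_quot kernel_subgroup (g ^+ k).
    by apply/kernel_quotP; rewrite phiX phig.
  elim: k {x phix} => [|k IHk]; first by rewrite !expg0.
  by rewrite !expgS to_quotM IHk.
have /boundG le_n := cycQ.
have /pcard_leP[h] := le_n.
have lt_h b : (h b < n)%N by exact: (@funS _ _ _ _ h).
(* The value 1 off the image is a default; [pre] matters only on [A]. *)
pose pre a : G :=
  if pselect (exists x, phi x = a) is left e then sval (cid e) else 1.
have preK b : b \in A -> phi (pre b) = b.
  by rewrite /pre => /surjA; case: pselect => // e _; apply: (svalP (cid e)).
pose k b := Ordinal (lt_h (to_quot kernel_subgroup (pre b))).
have k_inj : {in A &, injective k}.
  move=> b c Ab Ac /(congr1 val) /= eqk.
  have /kernel_quotP : to_quot kernel_subgroup (pre b) = to_quot kernel_subgroup (pre c).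
    by apply: (@inj _ _ _ h); rewrite ?inE.
  by rewrite !preK.
by rewrite -(card_in_imset k_inj) -[leqRHS]card_ord max_card.
Qed.

End Kernel.

Definition bounded_cyclic_quotients (G : groupType) (n : nat) : Prop :=
  forall N : normal_subgroup G, cyclic_group (quot N) -> [set: quot N] #<= `I_n.

(** A cyclic quotient of order [p > n] is excluded, which leaves one of order [e > 1] with [e <= n],
    [e] dividing [m] and [p - 1]. Its least prime factor serves as [q], odd because [m] is. *)
Lemma chi_O_pfactor (G : groupType) (n m p : nat) :
    bounded_cyclic_quotients G n -> chi_O G m ->
    prime p -> (n < p)%N -> logn p m = 1%N ->
    (forall q, prime q -> (p <= q)%N -> q %| m -> sylow_forcing m q) ->
  exists2 q, [/\ prime q, odd q & (q <= n)%N] & p = 1 %[mod q].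
Proof.
move=> boundG [/= chiFm odd_m] p_pr lt_np pm forcing.
have [gT [phi [phiM phi_surj oT]]] := finite_quotient_finGroup chiFm.
have image_le e : cyclic_image [set: gT]%G e -> (e <= n)%N.
  case=> rT [f [cf <-]].
  have fphiM : {morph f \o phi : x y / x * y}.
    by move=> x y; rewrite /= phiM morphM ?inE.
  apply: (cyclic_image_le fphiM boundG) cf => [x|a /morphimP[b _ _ ->]].
    by rewrite mem_morphim ?inE.
  by have [x <-] := phi_surj b; exists x.
case: (@cyclic_image_pfactor gT [set: gT]%G p); rewrite ?oT //=.
  by move/image_le; rewrite leqNgt lt_np.
case=> e [e_gt1 em ep /image_le le_en].
exists (pdiv e).
  rewrite pdiv_prime // (leq_trans (pdiv_leq _)) ?(ltnW e_gt1) //.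
  by split=> //; apply: dvdn_odd (dvdn_trans (pdiv_dvd e) em) odd_m.
apply/eqP; rewrite eqn_mod_dvd ?prime_gt0 // subn1.
exact: dvdn_trans (pdiv_dvd e) ep.
Qed.

Local Close Scope group_scope.

(** * The density *)

Local Open Scope ring_scope.

Lemma card_fset_set_count_le (X : set nat) (P : pred nat) (n : nat) :
    (forall k, (1 <= k <= n)%N -> X k -> P k) ->
  (#|` fset_set (X `&` [set k | (1 <= k <= n)%N])| <= count P (iota 1 n))%N.
Proof.
move=> XP; set A := X `&` _.
have finA : finite_set A.
  apply: (@sub_finite_set _ _ `I_n.+1) (finite_II _) => k [_ /andP[_ le_kn]] /=.
  by rewrite ltnS.
rewrite -size_filter; apply: uniq_leq_size (fset_uniq _) _ => k.
rewrite in_fset_set // inE => -[Xk kn].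
by rewrite mem_filter (XP k) //= mem_iota add1n ltnS.
Qed.

(** If no prime from [z] on is bad for [k], Sylow forcing holds at all prime divisors [q >= p] of
    [k], for any [p] in [T]. Were [p] an exact divisor, [chi_O_pfactor] would contradict the choice
    of [T]. *)
Lemma chi_O_cover (G : groupType) (n z x k : nat) (T : seq nat) :
    bounded_cyclic_quotients G n -> chi_O G k -> (0 < z)%N -> (1 <= k <= x)%N ->
    all prime T -> (forall p, p \in T -> (maxn n z < p)%N) ->
    (forall p q, p \in T -> prime q -> odd q -> (q <= n)%N -> p <> 1 %[mod q]) ->
  has (fun p => prime p && bad_prime p k) (iota z x) || no_exact_dvd T k.
Proof.
move=> boundG chik z_gt0 /andP[k_gt0 le_kx] prT T_gt T_mod.
have [//|/hasPn not_bad] := boolP (has _ _).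
apply/allP => p pT; apply/negP => exact_p.
have p_pr := allP prT p pT; have := T_gt p pT; rewrite gtn_max => /andP[lt_np lt_zp].
have logp : logn p k = 1%N by apply/eqP; rewrite -logn_exact_dvd.
case: (chi_O_pfactor boundG chik p_pr lt_np logp) => [q q_pr le_pq qk|q [q_pr q_odd le_qn]].
  apply: (not_bad_prime q_pr qk k_gt0 _).2.
  have := not_bad q; rewrite mem_iota q_pr /=; apply.
  (* [q] lies in the range [iota z x] because [z < p <= q <= k <= x]. *)
  rewrite (leq_trans (ltnW lt_zp)) //= (leq_ltn_trans (dvdn_leq k_gt0 qk)) //.
  by rewrite (leq_ltn_trans le_kx) // -[ltnLHS]add0n ltn_add2r.
by apply: T_mod.
Qed.

Theorem theorem3p1 (R : realType) (G : groupType) :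
  BCQO G -> has_natural_density (chi_O G) (0 : R).
Proof.
case=> n _ boundG; apply/cvgrPdist_le => eps eps_gt0.
have eps2_gt0 : 0 < eps / 2 by rewrite divr_gt0.
have [z z_gt0 bad_le] := upper_density_bad_prime eps2_gt0.
(* The primes of [T] must exceed [n] and [z]; the 2 makes them at least 3. *)
pose m := maxn (maxn n z) 2.
have [T [uniqT prT T_gt T_mod prodT]] :=
  primes_not_1_mod_small (leq_maxr _ _ : (2 <= m)%N) eps2_gt0.
have [x0 no_exact_le] := upper_density_no_exact_dvd uniqT prT prodT.
exists x0.+1 => // x /= lt_x0x; have x_gt0 : (0 < x)%N by apply: leq_trans lt_x0x.
rewrite sub0r normrN ger0_norm ?divr_ge0 // ler_pdivrMr ?ltr0n //.
pose bad k := has (fun p => prime p && bad_prime p k) (iota z x).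
have le_nz : (maxn n z <= m)%N by apply: leq_maxl.
have le_n : (n <= m)%N by rewrite (leq_trans _ le_nz) // leq_maxl.
apply: (@le_trans _ _ (count (predU bad (no_exact_dvd T)) (iota 1 x))%:R).
  rewrite ler_nat; apply: card_fset_set_count_le => k kx chik.
  apply: (chi_O_cover boundG chik z_gt0 kx prT) => [p /T_gt|p q pT q_pr q_odd le_q].
    exact: leq_ltn_trans.
  by apply: T_mod => //; apply: leq_trans le_q le_n.
apply: (@le_trans _ _ (eps / 2 * x%:R + eps / 2 * x%:R)); last by rewrite -mulrDl -splitr.
apply: le_trans (lerD (bad_le x) (no_exact_le x (ltnW lt_x0x))).
by rewrite -natrD ler_nat -(count_predUI bad) leq_addr.
Qed.
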